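(* Let $I$ be a finite set, let $\alpha_\iota:\mathbb C^2\to\mathbb C$ be holomorphic and $\delta_{1,\iota},\delta_{2,\iota}>0$ for $\iota\in I$, and let $\mathfrak G(z)=(\mathrm{id}\otimes L_{\mathfrak G}(z))\circ\Delta$, $z=(z_1,z_2)\in\mathbb C^2$, be the family of operators on the Toeplitz algebra $\mathcal T$ with $$\forall m,n\in\mathbb N_0\ \forall z\in\mathbb C^2:\quad L_{\mathfrak G}(z)(R_{n,m})=\sum_{\iota\in I}\alpha_\iota(z)\,n^{\delta_{1,\iota}z_1}m^{\delta_{2,\iota}z_2},$$ such that $\mathfrak G(0)=1$. Let $T$ be the heat-semigroup on $\mathcal T$ (generated by the Laplacian $\Delta_{\mathcal T}$). Then: (i) If $\max\{\delta_{1,\iota}\Re(z_1),\ \delta_{2,\iota}\Re(z_2):\ \iota\in I\}<-1$, then $T(t)\mathfrak G(z_1,z_2)$ is of trace class for all $t\in\mathbb R_{\ge0}$. (ii) For all $t\in\mathbb R_{>0}$, $$\lim_{z_2\to0}\lim_{z_1\to0}\zeta(T(t),\mathfrak G)(z_1,z_2)=-\frac12-\sum_{k\in\mathbb N}(k+1)e^{-tk^2}$$ and $$\mathrm{Htr}_{\mathcal T,\zeta,\mathfrak G}(t)=\frac12-\sum_{k\in\mathbb N}(k-1)e^{-tk^2}.$$ (iii) $\displaystyle\lim_{t\searrow0}4\pi t\,\mathrm{Htr}_{\mathcal T,\zeta,\mathfrak G}(t)=-2\pi.$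
   Context: $\mathbb N=\{1,2,\dots\}$, $\mathbb N_0=\mathbb N\cup\{0\}$. $\mathcal T$ is the Toeplitz algebra, i.e. the universal unital C*-algebra generated by the right shift isometry $R$ on $\ell_2(\mathbb N_0)$; $R_{n,m}:=R^n(R^* )^m$ $(n,m\in\mathbb N_0)$ form a basis of the dense *-subalgebra $\mathcal T_0$. The comultiplication is $\Delta(R_{n,m})=R_{n,m}\otimes R_{n,m}$, so $(\mathrm{id}\otimes L)\circ\Delta$ acts by $R_{n,m}\mapsto L(R_{n,m})R_{n,m}$. Brownian motion on $\mathcal T$ has generating functional $L_{BM}(R_{n,m})=-\frac{(n-m)^2}{2}$; the Laplacian is $\Delta_{\mathcal T}:=2(\mathrm{id}\otimes L_{BM})\circ\Delta$, i.e. $\Delta_{\mathcal T}R_{n,m}=-(n-m)^2R_{n,m}$, and the heat-semigroup satisfies $T(t)R_{n,m}=e^{-t(n-m)^2}R_{n,m}$. Traces are spectral: an operator $R_{n,m}\mapsto\lambda_{n,m}R_{n,m}$ is of trace class if $(\lambda_{n,m})$ is absolutely summable and then has trace $\sum_{n,m}\lambda_{n,m}$. In the gauged traces, the terms with $m=0$ or $n=0$ are taken to be identically $0$ (gauging them yields the constant function $0$). So $\operatorname{tr}(T(t)\mathfrak G(z))=\sum_{m,n\in\mathbb N}\sum_{\iota\in I}\alpha_\iota(z)e^{-t(n-m)^2}n^{\delta_{1,\iota}z_1}m^{\delta_{2,\iota}z_2}$ for $\Re(z_1),\Re(z_2)$ sufficiently small (i.e. sufficiently negative). $\zeta(T(t),\mathfrak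 G)$ is the maximal holomorphic extension of $z\mapsto\operatorname{tr}(T(t)\mathfrak G(z))$ with open connected domain in $\mathbb C^2$ containing $\{\Re(z_1)<r,\Re(z_2)<r\}$ for some sufficiently small $r\in\mathbb R$. In the iterated limit, one first continues to $z_1=0$ for $\Re(z_2)$ sufficiently negative and then continues the result holomorphically in $z_2$ to $z_2=0$. The $\zeta$-regularized heat-trace is obtained by adding back the terms with $m=0$ or $n=0$: $$\mathrm{Htr}_{\mathcal T,\zeta,\mathfrak G}(t):=\lim_{z_2\to0}\lim_{z_1\to0}\zeta(T(t),\mathfrak G)(z_1,z_2)+\sum_{\substack{m,n\in\mathbb N_0\\ mn=0}}e^{-t(n-m)^2}.$$ *)

(* Defs.v *)
From HB Require Import structures.
From mathcomp Require Import all_boot all_order all_algebra.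
From mathcomp Require Import finmap.
From mathcomp Require Import monalg.
From mathcomp Require Import complex.
From mathcomp Require Import all_classical all_reals all_analysis.
From mathcomp Require Import zify ring lra.

Set Implicit Arguments.
Unset Strict Implicit.
Unset Printing Implicit Defensive.

Import Order.TTheory GRing.Theory Num.Theory.
Import numFieldNormedType.Exports.
Local Open Scope classical_set_scope.
Local Open Scope complex_scope.
Local Open Scope ring_scope.

(** * Complex powers and unconditional sums *)

Section complex_analysis.
Variable R : realType.
Local Notation C := (R[i]).

Definition cexp (z : C) : C :=
  (expR (complex.Re z))%:C * (cos (complex.Im z) +i* sin (complex.Im z)).

(* n ^ w for n in N_0.  The convention is 0 ^ w = 0 for w != 0 and 0 ^ 0 = 1:
   gauging a term with a zero index gives the zero function, while the gauge
   at z = 0 can still be the identity on all of the basis. *)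
Definition cpow (n : nat) (w : C) : C :=
  if n is 0 then (w == 0)%:R else cexp (w * (ln n%:R)%:C).

Definition abs_summable (K : choiceType) (u : K -> C) : Prop :=
  esum.summable [set: K] (fun k => (Normc.normc (u k))%:E).

(* Limit of the finite partial sums along the finite subsets of K ordered by
   inclusion; it is only meaningful for absolutely summable families. *)
Definition csum (K : choiceType) (u : K -> C) : C :=
  lim ((fun A : {fset K} => \sum_(k <- A) u k : C^o) @
       filter_from [set: {fset K}] (fun A => [set B : {fset K} | (A `<=` B)%fset])).

(* Complex (Frechet) differentiability over the base field C. *)
Definition holomorphic (V W : normedModType C) (U : set V) (f : V -> W) : Prop :=
  forall z, U z -> differentiable f z.

Definition nsum (u : nat -> R) : R := limn (fun N => \sum_(1 <= k < N) u k).

Lemma cvg_real_complex (T : Type) (F : set_system T) (FF : Filter F) (u : T -> R) (l : R) :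
  u @ F --> l -> (((u x)%:C : C^o) @[x --> F] --> (l%:C : C^o)).
Proof.
move=> /cvgrPdist_lt ul; apply/cvgrPdist_lt => e e0.
have e_real : e = (complex.Re e)%:C by rewrite RRe_real // gtr0_real.
have : 0 < complex.Re e by rewrite -ltcR -e_real.
move=> /ul; apply: filterS => x; rewrite e_real -rmorphB /= normc_def /=.
by rewrite expr0n addr0 sqrtr_sqr ltcR.
Qed.

End complex_analysis.

(** * The dense *-subalgebra of the Toeplitz algebra *)

Section toeplitz.
Variable R : realType.
Local Notation C := (R[i]).

(* Linear extension of a map given on the basis K of the free module. *)
Definition lext (K : choiceType) (V : lmodType C) (v : K -> V)
  (x : {malg C[K]}) : V := \sum_(k <- msupp x) x@_k *: v k.

Section lext_theory.
Variables (K : choiceType) (V : lmodType C) (v : K -> V).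

Lemma lextwE (d : {fset K}) (x : {malg C[K]}) : (msupp x `<=` d)%fset ->
  lext v x = \sum_(k <- d) x@_k *: v k.
Proof.
move=> xd; apply: big_fset_incl => // k _ /mcoeff_outdom ->.
by rewrite scale0r.
Qed.

Lemma lextU k : lext v << k >> = v k.
Proof.
by rewrite (lextwE (msuppU_le (k:=k) (x:=1))) big_seq_fset1 mcoeffUU scale1r.
Qed.

Lemma lext_linear (a : C) (x y : {malg C[K]}) :
  lext v (a *: x + y) = a *: lext v x + lext v y.
Proof.
pose d := (msupp x `|` msupp y)%fset.
have xd : (msupp x `<=` d)%fset by apply: fsubsetUl.
have yd : (msupp y `<=` d)%fset by apply: fsubsetUr.
have xyd : (msupp (a *: x + y) `<=` d)%fset.
  apply: fsubset_trans (msuppD_le _ _) _.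
  by rewrite fsubUset yd andbT (fsubset_trans (msuppZ_le _ _) xd).
rewrite (lextwE xd) (lextwE yd) (lextwE xyd) scaler_sumr -big_split /=.
by apply: eq_bigr => k _; rewrite mcoeffD mcoeffZ scalerDl scalerA.
Qed.

End lext_theory.

(* T_0 is the free vector space on the R_{n,m} = R^n (R^* )^m; toep_inj below
   identifies it with the span of these operators. *)
Definition T0 := {malg C[(nat * nat)%type]}.
Definition T0T0 := {malg C[((nat * nat) * (nat * nat))%type]}.
Definition Rnm (n m : nat) : T0 := << (n, m) >>.
Definition tens (k l : nat * nat) : T0T0 := << (k, l) >>.

Section shift.
Implicit Types (f : nat -> C) (x : T0).

(* The right shift, its adjoint, and the operators R^n (R^* )^m; they are
   written on all sequences and restrict to l_2(N_0). *)
Definition shift f : nat -> C := fun j => if j is j'.+1 then f j' else 0.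
Definition coshift f : nat -> C := fun j => f j.+1.
Definition shift_op n m f : nat -> C := iter n shift (iter m coshift f).

Definition toep x f : nat -> C := fun j =>
  lext (V := C^o) (fun k => shift_op k.1 k.2 f j) x.

Lemma toepE n m f : toep (Rnm n m) f = shift_op n m f.
Proof. by apply/funext => j; rewrite /toep lextU. Qed.

Lemma shift_opE n m f j :
  shift_op n m f j = if (n <= j)%N then f (j - n + m)%N else 0.
Proof.
have iterE i : iter m coshift f i = f (i + m)%N.
  by elim: m i => [|m IH] i; rewrite ?addn0// iterS /coshift IH addSnnS.
by elim: n j => [|n IH] [|j]; rewrite /shift_op ?iterS ?iterE ?subn0//= -IH.
Qed.

Lemma shift_opM n m p q f :
  shift_op n m (shift_op p q f) = shift_op (n + (p - m)) (q + (m - p)) f.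
Proof.
apply/funext => j; rewrite !shift_opE.
have [nj|jn] := leqP n j; last by rewrite ifF//; lia.
have [pj|jp] := leqP p (j - n + m); last by rewrite ifF//; lia.
by rewrite ifT; [congr f; lia | lia].
Qed.

Definition delta (p : nat) : nat -> C := fun j => (j == p)%:R.

Lemma toep_coef x n m : x@_(n, m) = toep x (delta m) n -
  (if n is n'.+1 then if m is m'.+1 then toep x (delta m') n' else 0 else 0).
Proof.
rewrite [in LHS](monalgE x) raddf_sum /=.
have -> : (if n is n'.+1 then if m is m'.+1 then toep x (delta m') n' else 0 else 0) =
  \sum_(k <- msupp x) x@_k *: (if n is n'.+1 then if m is m'.+1 then
     shift_op k.1 k.2 (delta m') n' else 0 else 0 : C^o).
  by case: n m => [|n] [|m] //; rewrite big1// => k _; rewrite scaler0.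
rewrite -sumrB; apply: eq_bigr => -[p q] _.
rewrite mcoeffU -scalerBr /= -mulr_natr; congr (_ * _).
rewrite xpair_eqE shift_opE /delta.
have bE (P Q : bool) : (if P then Q%:R else 0) = (P && Q)%:R :> C.
  by case: P.
case: n m => [|n] [|m]; rewrite ?subr0 bE.
- by congr (nat_of_bool _)%:R; lia.
- by congr (nat_of_bool _)%:R; lia.
- by congr (nat_of_bool _)%:R; lia.
rewrite shift_opE bE; have [pn|np] := leqP p n; last first.
  by rewrite subr0; congr (nat_of_bool _)%:R; lia.
have -> : (p <= n.+1)%N && (n.+1 - p + q == m.+1)%N = (n - p + q == m)%N by lia.
by rewrite subrr; have -> : (p == n.+1) = false by lia.
Qed.

Lemma toep_inj x y : toep x = toep y -> x = y.
Proof.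
move=> xy; apply/malgP => -[n m]; rewrite !toep_coef.
by case: n m => [|n] [|m]; rewrite xy.
Qed.

End shift.

(* Comultiplication: R_{n,m} |-> R_{n,m} (x) R_{n,m}. *)
Definition comul : T0 -> T0T0 := lext (fun k => tens k k).

(* id (x) L : x (x) y |-> L(y) x. *)
Definition id_tens (L : T0 -> C) : T0T0 -> T0 :=
  lext (fun p => L (Rnm p.2.1 p.2.2) *: Rnm p.1.1 p.1.2).

Definition convop (L : T0 -> C) : T0 -> T0 := id_tens L \o comul.

Definition functional (l : nat -> nat -> C) : T0 -> C :=
  lext (V := C^o) (fun k => l k.1 k.2).

Lemma convopE (L : T0 -> C) n m : convop L (Rnm n m) = L (Rnm n m) *: Rnm n m.
Proof. by rewrite /convop /= /comul lextU /id_tens lextU. Qed.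

Lemma convop_linear (L : T0 -> C) (a : C) (x y : T0) :
  convop L (a *: x + y) = a *: convop L x + convop L y.
Proof. by rewrite /convop /= /comul lext_linear /id_tens lext_linear. Qed.

Lemma functionalE l n m : functional l (Rnm n m) = l n m.
Proof. by rewrite /functional lextU. Qed.

Lemma convop_coef (L : T0 -> C) (x : T0) k :
  (convop L x)@_k = L (Rnm k.1 k.2) * x@_k.
Proof.
have convop0 : convop L 0 = 0.
  by have := convop_linear L (-1) 0 0; rewrite scaler0 addr0 scaleN1r addNr.
suff H (s : seq (nat * nat)) : (convop L (\sum_(l <- s) << x@_l *g l >>))@_k =
    L (Rnm k.1 k.2) * (\sum_(l <- s) << x@_l *g l >>)@_k.
  by have := H (msupp x); rewrite -monalgE.
elim: s => [|[n m] s IH]; first by rewrite !big_nil convop0 !mcoeff0 mulr0.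
rewrite !big_cons.
have -> : << x@_(n, m) *g (n, m) >> = x@_(n, m) *: Rnm n m.
  by apply/malgP => l; rewrite mcoeffZ !mcoeffU mulrnAr mulr1.
rewrite convop_linear convopE mcoeffD IH mcoeffD mulrDr; congr (_ + _).
have RE (c : C) : (c *: Rnm n m)@_k = c *+ ((n, m) == k).
  by rewrite mcoeffZ mcoeffU mulrnAr mulr1.
apply: (etrans (congr1 (mcoeff k) (scalerA _ _ _))); apply: (etrans (RE _)).
apply: esym; apply: (etrans (congr1 ( *%R _) (RE _))).
by case: eqP => [<-|_]; [rewrite mulrC | rewrite mulr0].
Qed.

Definition L_BM : T0 -> C :=
  functional (fun n m => - ((n%:R - m%:R) ^+ 2 / 2)).

Definition laplacian (x : T0) : T0 := 2 *: convop L_BM x.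

(* The semigroup exp(t Laplacian), i.e. the convolution semigroup
   of the functionals R_{n,m} |-> exp(2 t L_BM(R_{n,m})); see heat_generator. *)
Definition heat (t : R) : T0 -> T0 :=
  convop (functional (fun n m => cexp ((2 * t)%:C * L_BM (Rnm n m)))).

Lemma laplacianE n m :
  laplacian (Rnm n m) = - (n%:R - m%:R) ^+ 2 *: Rnm n m.
Proof.
by rewrite /laplacian convopE /L_BM functionalE scalerA mulrN mulrCA divff ?mulr1// pnatr_eq0.
Qed.

Lemma heatE (t : R) n m :
  heat t (Rnm n m) = (expR (- t * (n%:R - m%:R) ^+ 2))%:C *: Rnm n m.
Proof.
rewrite /heat convopE functionalE /= /L_BM functionalE; congr (_ *: _).
have -> : (2 * t)%:C * - ((n%:R - m%:R) ^+ 2 / 2) =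
    (- t * (n%:R - m%:R) ^+ 2)%:C :> C.
  rewrite !(rmorphM, rmorphN, rmorphB, rmorphXn, rmorph_nat) /=.
  by rewrite -mulrA !mulrN mulNr mulrCA (mulrCA 2) divff ?mulr1 // pnatr_eq0.
by rewrite /cexp /= cos0 sin0 mulr1.
Qed.

Lemma heat_coef (t : R) (x : T0) k :
  (heat t x)@_k = (expR (- t * (k.1%:R - k.2%:R) ^+ 2))%:C * x@_k.
Proof.
rewrite /heat convop_coef; congr (_ * _).
have := congr1 (mcoeff k) (heatE t k.1 k.2).
by rewrite /heat convop_coef mcoeffZ /Rnm -surjective_pairing mcoeffUU !mulr1.
Qed.

Lemma heat0 (x : T0) : heat 0 x = x.
Proof. by apply/malgP => k; rewrite heat_coef oppr0 mul0r expR0 mul1r. Qed.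

Lemma heatD (s t : R) (x : T0) : heat (s + t) x = heat s (heat t x).
Proof.
apply/malgP => k; apply: (etrans (heat_coef _ _ _)); apply: esym.
apply: (etrans (heat_coef _ _ _)); apply: (etrans (congr1 ( *%R _) (heat_coef _ _ _))).
by rewrite mulrA -rmorphM -expRD -mulrDl -opprD.
Qed.

Lemma laplacian_coef (x : T0) k :
  (laplacian x)@_k = - ((k.1%:R - k.2%:R) ^+ 2)%:C * x@_k.
Proof.
apply: (etrans (mcoeffZ _ _ _)); apply: (etrans (congr1 ( *%R _) (convop_coef _ _ _))).
rewrite mulrA /L_BM functionalE mulrN mulrCA divff ?mulr1 ?pnatr_eq0//.
by rewrite rmorphXn rmorphB /= !rmorph_nat.
Qed.

Lemma heat_generator (x : T0) k :
  ((h^-1)%:C * ((heat h x)@_k - x@_k) : C^o) @[h --> (0 : R)^'] -->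
  ((laplacian x)@_k : C^o).
Proof.
rewrite laplacian_coef; set c := (k.1%:R - k.2%:R) ^+ 2.
have dE : is_derive (0 : R) (1 : R) (fun h => expR (- h * c)) (- c).
  apply: is_derive_eq.
  rewrite /GRing.scale /= oppr0 mul0r expR0.
  by rewrite mul1r mul0r add0r mulrN1.
have lim : h^-1 * (expR (- h * c) - 1) @[h --> (0 : R)^'] --> - c.
  have [dv dval] := dE; rewrite -dval; apply: cvg_trans dv.
  apply: near_eq_cvg; near=> h => /=.
  by rewrite addr0 oppr0 mul0r expR0 /GRing.scale /= mulr1.
have -> : (fun h : R => (h^-1)%:C * ((heat h x)@_k - x@_k) : C^o) =
   (fun h => (h^-1 * (expR (- h * c) - 1))%:C * x@_k).
  apply/funext => h; rewrite [in RHS]rmorphM rmorphB /= -mulrA mulrBl mul1r.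
  by congr (_ * (_ - _)); exact: heat_coef.
rewrite -rmorphN.
by apply: cvgMr_tmp; apply: cvg_real_complex.
Unshelve. all: by end_near. Qed.

Section gauge.
Variables (I : finType) (alpha : I -> C^o * C^o -> C^o) (delta1 delta2 : I -> R).

Definition L_gauge (z : C^o * C^o) : T0 -> C :=
  functional (fun n m => \sum_(i : I) alpha i z *
    cpow n ((delta1 i)%:C * z.1) * cpow m ((delta2 i)%:C * z.2)).

Definition gauge (z : C^o * C^o) : T0 -> T0 := convop (L_gauge z).

End gauge.

Lemma gaugeE (I : finType) (alpha : I -> C^o * C^o -> C^o) (d1 d2 : I -> R) z n m :
  gauge alpha d1 d2 z (Rnm n m) =
  (\sum_(i : I) alpha i z * cpow n ((d1 i)%:C * z.1) * cpow m ((d2 i)%:C * z.2))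
    *: Rnm n m.
Proof. by rewrite /gauge convopE /L_gauge functionalE. Qed.

(** * Spectral traces, the zeta-function and the regularized heat-trace *)

Definition eigenv (A : T0 -> T0) (k : nat * nat) : C := (A (Rnm k.1 k.2))@_k.

Definition trace_class (A : T0 -> T0) : Prop :=
  (forall n m, A (Rnm n m) = eigenv A (n, m) *: Rnm n m) /\
  abs_summable (eigenv A).

Definition sptrace (A : T0 -> T0) : C := csum (eigenv A).

Definition holo_extension (A : C^o * C^o -> T0 -> T0)
    (U : set (C^o * C^o)) (f : C^o * C^o -> C^o) : Prop :=
  [/\ open U, connected U, holomorphic U f &
      exists r : R, forall z : C^o * C^o,
        complex.Re z.1 < r -> complex.Re z.2 < r ->
        [/\ U z, trace_class (A z) & f z = sptrace (A z)]].

(* (U, f) is the maximal holomorphic extension of z |-> tr (A z), in the sense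
   of the inclusion of graphs: every other extension is a restriction of f.
   For the gauged heat traces at t > 0 it exists, since the trace extends
   meromorphically to C^2, with polar set contained in the hyperplanes
   delta1 z1 + delta2 z2 = j - 1 for j in N_0. *)
Definition is_zeta (A : C^o * C^o -> T0 -> T0)
    (U : set (C^o * C^o)) (f : C^o * C^o -> C^o) : Prop :=
  holo_extension A U f /\
  forall V g, holo_extension A V g -> V `<=` U /\ (forall z, V z -> g z = f z).

(* l = lim_(z2 -> 0) lim_(z1 -> 0) f (z1, z2): the inner limit, which exists for
   Re z2 sufficiently negative, is continued holomorphically in z2, inside the
   domain U of f, along a connected open set W that contains z2 = 0. *)
Definition iterated_limit (U : set (C^o * C^o)) (f : C^o * C^o -> C^o)
    (l : C^o) : Prop :=
  exists (W : set C^o) (g : C^o -> C^o),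
    [/\ open W, connected W, holomorphic W g & W 0] /\
    [/\ exists s : R, forall w : C^o, complex.Re w < s -> W w,
        forall w : C^o, W w ->
          U (0, w) /\ f (z1, w) @[z1 --> (0 : C^o)^'] --> g w
      & g w @[w --> (0 : C^o)^'] --> l].

(* Regularized heat-trace at time t, for the zeta-function f on U. *)
Definition Htr (t : R) (U : set (C^o * C^o)) (f : C^o * C^o -> C^o) : C :=
  xget 0 [set l : C^o | iterated_limit U f l] +
  csum (fun k : nat * nat =>
    if (k.1 * k.2 == 0)%N then (expR (- t * (k.1%:R - k.2%:R) ^+ 2))%:C else 0).

End toeplitz.

(* Main.v *)
(* Put [s = a + b] and [theta = \sum_(k >= 1) e^(-t k^2)].  Since
   [n^a m^b + n^b m^a = n^s + m^s - (n^a - m^a) (n^b - m^b)], the symmetric sum of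
   [e^(-t (n-m)^2) n^a m^b] over [n, m >= 1] is
   [(1 + 2 theta) zeta(-s) - \sum_m T_m m^s - Q(a, b) / 2], where [T_m] is the
   tail [\sum_(k >= m) e^(-t k^2)] and
   [Q(a, b) = \sum_(n, m) e^(-t (n-m)^2) (n^a - m^a) (n^b - m^b)].  The difference
   [n^a - m^a] gains a factor [1 / m], so [Q] converges for [Re s < 1], and
   [zeta(-s)] is continued through the alternating zeta function.  In particular
   the trace is holomorphic at the origin, where [Q = 0], [zeta(0) = -1/2] and
   [\sum_m T_m = \sum_k k e^(-t k^2)]; the iterated limit is this value.  As [t]
   tends to [0], telescoping [e^(-t k^2)] gives
   [|2 t \sum_k k e^(-t k^2) - 1| <= t (1 + theta)], while [t theta] tends to [0]. *)

Require Import Defs.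
From HB Require Import structures.
From mathcomp Require Import all_boot all_order all_algebra.
From mathcomp Require Import finmap monalg.
From mathcomp Require Import complex.
From mathcomp Require Import all_classical all_reals all_analysis.
From mathcomp Require Import zify ring lra.

Set Implicit Arguments.
Unset Strict Implicit.
Unset Printing Implicit Defensive.

Import Order.TTheory GRing.Theory Num.Theory.
Import numFieldNormedType.Exports.
Local Open Scope classical_set_scope.
Local Open Scope complex_scope.
Local Open Scope ring_scope.

(** * Norm, exponential and sequences of complex numbers *)

Section complex_norm.
Variable R : realType.
Local Notation C := R[i].
Local Notation nc := (@Normc.normc R).
Implicit Types (x y : R) (z w : C).

(** An expansion along the diagonals [n - m = k] would need a continuation of [\sum_n n^a (n + k)^b]
    that is uniform in [k]. Symmetrising avoids this: the only factor left to continue past its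
    series is a function of the single variable [s], and whatever depends on [a] and [b] separately
    converges absolutely near the origin. Only the origin is wanted, so everything is continued just
    to [Re s < 1 / 2]; this leaves room for a ball of radius [1 / 16] around each point while all
    majorants stay of order [j^(-5/4)]. The quotient [dirichlet_eta s / (1 - 2^(1+s))] is undefined
    at [s = -1] and also at the artificial points [-1 + 2 pi i k / ln 2]; the domain of the
    extension therefore crosses the line [Re s = -1] through a strip just above the real axis. The
    maximal extension is never constructed. It restricts to the explicit continuation, and
    holomorphy at the origin forces every iterated limit to be the value there. *)

Lemma nc_ge0 z : 0 <= nc z.
Proof. by case: z => a b; rewrite /Normc.normc sqrtr_ge0. Qed.

Lemma nc0 : nc 0 = 0.
Proof. by rewrite /Normc.normc /= expr0n addr0 sqrtr0. Qed.

Lemma nc1 : nc 1 = 1.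
Proof. by rewrite /Normc.normc /= expr1n expr0n addr0 sqrtr1. Qed.

Lemma nc_real x : nc x%:C = `|x|.
Proof. by rewrite /= expr0n addr0 sqrtr_sqr. Qed.

Lemma ncM z w : nc (z * w) = nc z * nc w.
Proof. exact: Normc.normcM. Qed.

Lemma ncN z : nc (- z) = nc z.
Proof. exact: normcN. Qed.

Lemma le_ncD z w : nc (z + w) <= nc z + nc w.
Proof. exact: le_normcD. Qed.

Lemma nc_eq0 z : nc z = 0 -> z = 0.
Proof. exact: Normc.eq0_normc. Qed.

Lemma le_nc_sum (K : Type) (s : seq K) (P : pred K) (u : K -> C) :
  nc (\sum_(k <- s | P k) u k) <= \sum_(k <- s | P k) nc (u k).
Proof.
elim/big_ind2: _ => [|z x w y zx wy|//]; first by rewrite nc0.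
by apply: le_trans (le_ncD _ _) _; exact: lerD.
Qed.

Lemma le_Re_nc z : `|complex.Re z| <= nc z.
Proof.
case: z => a b /=; rewrite -sqrtr_sqr ler_sqrt ?addr_ge0 ?sqr_ge0//.
by rewrite lerDl sqr_ge0.
Qed.

Lemma le_Im_nc z : `|complex.Im z| <= nc z.
Proof.
case: z => a b /=; rewrite -sqrtr_sqr ler_sqrt ?addr_ge0 ?sqr_ge0//.
by rewrite lerDr sqr_ge0.
Qed.

Lemma nc_le_ReIm z : nc z <= `|complex.Re z| + `|complex.Im z|.
Proof.
case: z => a b /=; rewrite -[leRHS]ger0_norm ?addr_ge0// -sqrtr_sqr.
rewrite ler_sqrt ?sqr_ge0// sqrrD !real_normK ?num_real//.
by rewrite lerD2r lerDl mulrn_wge0// mulr_ge0.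
Qed.

Lemma Re_add z w : complex.Re (z + w) = complex.Re z + complex.Re w.
Proof. by case: z; case: w. Qed.

Lemma Im_add z w : complex.Im (z + w) = complex.Im z + complex.Im w.
Proof. by case: z; case: w. Qed.

Lemma Re_mulR z x : complex.Re (z * x%:C) = complex.Re z * x.
Proof. by case: z => a b /=; rewrite mulr0 subr0. Qed.

Lemma Im_mulR z x : complex.Im (z * x%:C) = complex.Im z * x.
Proof. by case: z => a b /=; rewrite mulr0 add0r. Qed.

End complex_norm.

Section complex_exponential.
Variable R : realType.
Local Notation C := R[i].
Local Notation nc := (@Normc.normc R).
Implicit Types (x y : R) (z w : C).

Lemma cexpD z w : cexp (z + w) = cexp z * cexp w.
Proof.
rewrite /cexp Re_add Im_add expRD rmorphM /= cosD sinD.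
case: z w => a b [c d] /=; simpc; congr (_ +i* _); ring.
Qed.

Lemma cexp0 : cexp 0 = 1 :> C.
Proof. by rewrite /cexp /= expR0 cos0 sin0 mul1r. Qed.

Lemma cexp_real x : cexp x%:C = (expR x)%:C.
Proof. by rewrite /cexp /= cos0 sin0 mulr1. Qed.

Lemma nc_cexp z : nc (cexp z) = expR (complex.Re z).
Proof.
rewrite /cexp ncM nc_real ger0_norm ?expR_ge0//.
by rewrite /Normc.normc cos2Dsin2 sqrtr1 mulr1.
Qed.

(** Used repeatedly below: the bound for the derivative is a previous estimate, so each use gains
    one factor [|x|]. *)
Lemma MVT_bound (f df : R -> R) (K x : R) :
  (forall y, is_derive y 1 f (df y)) ->
  (forall y, `|y| <= `|x| -> `|df y| <= K) -> `|f x - f 0| <= K * `|x|.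
Proof.
move=> fdf dfK.
have cf a b : {within `[a, b], continuous f}.
  apply: continuous_subspaceT => y; apply: differentiable_continuous.
  by apply/derivable1_diffP; have [] := fdf y.
have [x0|x0] := leP 0 x.
  have [c] := MVT_segment x0 (fun y _ => fdf y) (cf 0 x).
  rewrite in_itv /= => /andP[c0 cx] ->; rewrite subr0 normrM.
  by rewrite ler_wpM2r// dfK// !ger0_norm.
have [c] := MVT_segment (ltW x0) (fun y _ => fdf y) (cf x 0).
rewrite in_itv /= => /andP[xc c0] E; rewrite distrC E sub0r normrM normrN.
by rewrite ler_wpM2r// dfK// !ler0_norm ?lerN2// ltW.
Qed.

Lemma abs_sin_le x : `|sin x| <= `|x|.
Proof.
have := @MVT_bound (@sin R) (@cos R) 1 x.
by rewrite sin0 subr0 mul1r; apply=> // y _; exact: cos_max.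
Qed.

Lemma abs_cos1_le x : `|cos x - 1| <= `|x|.
Proof.
have := @MVT_bound (@cos R) (fun y => - sin y) 1 x.
by rewrite cos0 mul1r; apply=> // y _; rewrite normrN; exact: sin_max.
Qed.

Lemma abs_cos1_le2 x : `|cos x - 1| <= x ^+ 2.
Proof.
have := @MVT_bound (@cos R) (fun y => - sin y) `|x| x.
rewrite cos0 -normrM ger0_norm ?sqr_ge0//; apply=> // y yx.
by rewrite normrN (le_trans (abs_sin_le _)).
Qed.

Lemma abs_sin_id_le2 x : `|sin x - x| <= x ^+ 2.
Proof.
have := @MVT_bound (fun y => sin y - y) (fun y => cos y - 1) `|x| x.
rewrite sin0 !subr0 -normrM ger0_norm ?sqr_ge0//; apply=> // y yx.
by rewrite (le_trans (abs_cos1_le _)).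
Qed.

Lemma abs_expR1_le x : `|expR x - 1| <= `|x| * expR `|x|.
Proof.
have := @MVT_bound (@expR R) (@expR R) (expR `|x|) x.
rewrite expR0 mulrC; apply=> // y yx.
by rewrite ger0_norm ?expR_ge0// ler_expR (le_trans (ler_norm _)).
Qed.

Lemma abs_expR1_id_le2 x : `|expR x - 1 - x| <= x ^+ 2 * expR `|x|.
Proof.
have := @MVT_bound (fun y => expR y - y) (fun y => expR y - 1)
  (`|x| * expR `|x|) x.
rewrite expR0 subr0 (addrAC _ _ (-1)).
have -> : `|x| * expR `|x| * `|x| = x ^+ 2 * expR `|x|.
  by rewrite mulrAC -expr2 real_normK ?num_real.
apply=> // y yx; rewrite (le_trans (abs_expR1_le _))//.
by rewrite ler_pM ?expR_ge0// ler_expR.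
Qed.

Lemma nc_cexp_sub1_id z :
  nc (cexp z - 1 - z) <= 4 * nc z ^+ 2 * expR (nc z).
Proof.
case: z => x y; set z := x +i* y.
have xz : `|x| <= nc z by exact: (le_Re_nc z).
have yz : `|y| <= nc z by exact: (le_Im_nc z).
(* Three quadratic errors, trigonometric, mixed and exponential. They cost 2, 1 and 1 times
   [nc z ^+ 2 * expR (nc z)], whence the constant 4. *)
have -> : cexp z - 1 - z = (expR x)%:C * ((cos y - 1) +i* (sin y - y)) +
    (0 +i* (y * (expR x - 1))) + (expR x - 1 - x)%:C.
  by rewrite /cexp /z /=; simpc; congr (_ +i* _); ring.
have z0 := nc_ge0 z.
have Ez : expR `|x| <= expR (nc z) by rewrite ler_expR.
have x2 : x ^+ 2 <= nc z ^+ 2 by rewrite -real_normK ?num_real// lerXn2r// nnegrE.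
have y2 : y ^+ 2 <= nc z ^+ 2 by rewrite -real_normK ?num_real// lerXn2r// nnegrE.
have xy : `|y| * `|x| <= nc z ^+ 2 by rewrite expr2 ler_pM.
have Ex : expR x <= expR (nc z) by rewrite ler_expR (le_trans (ler_norm x)).
have h1 : nc ((expR x)%:C * ((cos y - 1) +i* (sin y - y))) <=
    2 * nc z ^+ 2 * expR (nc z).
  rewrite ncM nc_real ger0_norm ?expR_ge0// mulrC ler_pM ?nc_ge0 ?expR_ge0//.
  rewrite (le_trans (nc_le_ReIm _))//= mulr_natl mulr2n lerD//.
    exact: le_trans (abs_cos1_le2 _) _.
  exact: le_trans (abs_sin_id_le2 _) _.
have h2 : nc (0 +i* (y * (expR x - 1))) <= nc z ^+ 2 * expR (nc z).
  rewrite (le_trans (nc_le_ReIm _))//= normr0 add0r normrM.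
  apply: (@le_trans _ _ (`|y| * (`|x| * expR `|x|))).
    by rewrite ler_wpM2l// abs_expR1_le.
  by rewrite mulrA ler_pM ?mulr_ge0 ?expR_ge0.
have h3 : nc (expR x - 1 - x)%:C <= nc z ^+ 2 * expR (nc z).
  rewrite nc_real (le_trans (abs_expR1_id_le2 _))//.
  by rewrite ler_pM ?sqr_ge0 ?expR_ge0.
have := le_ncD ((expR x)%:C * ((cos y - 1) +i* (sin y - y)) +
    (0 +i* (y * (expR x - 1)))) (expR x - 1 - x)%:C.
have := le_ncD ((expR x)%:C * ((cos y - 1) +i* (sin y - y)))
    (0 +i* (y * (expR x - 1))).
lra.
Qed.

Lemma nc_cexp_sub1 z : nc (cexp z - 1) <= nc z * (1 + 4 * nc z) * expR (nc z).
Proof.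
have z0 := nc_ge0 z; have := nc_cexp_sub1_id z.
have := le_ncD (cexp z - 1 - z) z; rewrite subrK.
have : nc z * 1 <= nc z * expR (nc z)
  by rewrite ler_wpM2l// (le_trans _ (expR_ge1Dx _))// lerDl.
lra.
Qed.

End complex_exponential.

(** * Convergence of complex sequences and series *)

Section complex_sequences.
Variable R : realType.
Local Notation C := R[i].
Local Notation nc := (@Normc.normc R).
Implicit Types (s u : nat -> C) (l : C).

(** Stated through the real sequence of distances, so that limits follow from real squeeze
    arguments. *)
Definition ccvg s l := (fun N => nc (s N - l)) @ \oo --> (0 : R).

(** Taking real and imaginary parts reduces absolute convergence to the completeness of the reals.
    The value is meaningful only together with a [ccvg] fact such as [abs_series_cvg]. *)
Definition clim s : C :=
  limn (fun N => complex.Re (s N)) +i* limn (fun N => complex.Im (s N)).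

Lemma ccvg_le s l (e : R^nat) :
  (forall N, nc (s N - l) <= e N) -> e @ \oo --> 0 -> ccvg s l.
Proof.
move=> se e0; apply: (@squeeze_cvgr _ _ _ _ (fun=> 0) e) => //; last exact: cvg_cst.
by apply: nearW => N; rewrite nc_ge0 se.
Qed.

Lemma cvgn0D (x y : R^nat) : x @ \oo --> 0 -> y @ \oo --> 0 ->
  (fun N => x N + y N) @ \oo --> 0.
Proof. by move=> x0 y0; rewrite -[0](addr0 0); exact: cvgD. Qed.

Lemma ccvg_cst l : ccvg (fun=> l) l.
Proof.
apply: (@ccvg_le _ _ (fun=> 0)) => [N|]; last exact: cvg_cst.
by rewrite subrr nc0.
Qed.

Lemma ccvg_eq s s' l : s =1 s' -> ccvg s l -> ccvg s' l.
Proof. by move=> /funext ->. Qed.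

Lemma ccvgD s s' l l' :
  ccvg s l -> ccvg s' l' -> ccvg (fun N => s N + s' N) (l + l').
Proof.
move=> sl sl'; apply: (@ccvg_le _ _ (fun N => nc (s N - l) + nc (s' N - l'))).
  by move=> N; rewrite opprD addrACA le_ncD.
exact: cvgn0D.
Qed.

Lemma ccvgZ c s l : ccvg s l -> ccvg (fun N => c * s N) (c * l).
Proof.
move=> sl; apply: (@ccvg_le _ _ (fun N => nc c * nc (s N - l))).
  by move=> N; rewrite -mulrBr ncM.
by rewrite -(mulr0 (nc c)); apply: cvgMr.
Qed.

Lemma ccvgN s l : ccvg s l -> ccvg (fun N => - s N) (- l).
Proof.
move=> sl; rewrite -mulN1r; apply: (ccvg_eq _ (ccvgZ (-1) sl)) => N.
by rewrite mulN1r.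
Qed.

Lemma ccvgB s s' l l' :
  ccvg s l -> ccvg s' l' -> ccvg (fun N => s N - s' N) (l - l').
Proof. by move=> sl /ccvgN; exact: ccvgD. Qed.

(** This is how bounds on partial sums (value, derivative, remainder) pass to the sum in
    [taylor_bound_series]. *)
Lemma ccvg_nc_le s l B : (forall N, nc (s N) <= B) -> ccvg s l -> nc l <= B.
Proof.
move=> sB sl; have : (fun N => B + nc (s N - l)) @ \oo --> B + 0.
  by apply: cvgD => //; exact: cvg_cst.
rewrite addr0 => /cvg_lim <- //; apply: limr_ge.
  by apply: cvgP; apply: cvgD sl; exact: cvg_cst.
apply: nearW => N; have := le_ncD (s N) (- (s N - l)).
rewrite ncN opprB addrC subrK => /le_trans; apply.
by rewrite lerD2r sB.
Qed.

Lemma ccvg_unique s l l' : ccvg s l -> ccvg s l' -> l = l'.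
Proof.
move=> sl sl'; apply/eqP; rewrite -subr_eq0; apply/eqP/nc_eq0/le_anti.
rewrite nc_ge0 andbT; apply: (ccvg_nc_le _ (ccvgB sl sl')) => N.
by rewrite subrr nc0.
Qed.

Lemma ccvg_real (x : nat -> R) (l : R) :
  x @ \oo --> l -> ccvg (fun N => (x N)%:C) l%:C.
Proof.
move=> xl; apply: (@ccvg_le _ _ (fun N => `|x N - l|)) => [N|].
  by rewrite -rmorphB nc_real.
by rewrite -(normr0 R) -(subrr l); apply: cvg_norm; apply: cvgB => //; exact: cvg_cst.
Qed.

Lemma ccvg_sub s l (f : nat -> nat) :
  {homo f : m n / (m < n)%N} -> ccvg s l -> ccvg (s \o f) l.
Proof.
move=> f_incr sl; apply: (@cvg_comp _ _ _ f (fun N => nc (s N - l)) _ _ _ _ sl).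
by apply/cvgnyPge => N; near=> k; have : (N <= k)%N; [near: k; exact: nbhs_infty_ge|];
  move=> /leq_trans; apply; elim: {+}k => // m IH; apply: leq_trans (f_incr m m.+1 _).
Unshelve. all: by end_near. Qed.

Lemma bounded_series_cvg (M : R^nat) (B : R) : (forall j, 0 <= M j) ->
  (forall N, \sum_(j < N) M j <= B) -> cvgn (series M).
Proof.
move=> M0 MB; apply: nondecreasing_is_cvgn.
  by apply/nondecreasing_seqP => n; rewrite seriesSr lerDl M0.
by exists B => _ [n _ <-]; rewrite /series/= big_mkord MB.
Qed.

Lemma abs_series_cvg u (M : R^nat) (B : R) : (forall j, nc (u j) <= M j) ->
  (forall N, \sum_(j < N) M j <= B) ->
  ccvg (fun N => \sum_(j < N) u j) (clim (fun N => \sum_(j < N) u j)).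
Proof.
move=> uM MB.
have part (p : C -> R) : {morph p : z w / z + w} -> p 0 = 0 ->
    (forall z, `|p z| <= nc z) -> cvgn (fun N => p (\sum_(j < N) u j)).
  move=> pD p0 ple.
  have -> : (fun N => p (\sum_(j < N) u j)) = series (p \o u).
    by apply/funext => N; rewrite /series/= big_mkord (big_morph p pD p0).
  apply: normed_cvg; apply: (@series_le_cvg _ _ M) => //= [j|j|].
  - exact: le_trans (nc_ge0 _) (uM j).
  - exact: le_trans (ple _) (uM j).
  - apply: (@bounded_series_cvg _ B) => // j.
    exact: le_trans (nc_ge0 _) (uM j).
have cRe : cvgn (fun N => complex.Re (\sum_(j < N) u j)).
  by apply: part => //; [exact: Re_add|exact: le_Re_nc].
have cIm : cvgn (fun N => complex.Im (\sum_(j < N) u j)).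
  by apply: part => //; [exact: Im_add|exact: le_Im_nc].
apply: (@ccvg_le _ _ (fun N =>
  `|complex.Re (\sum_(j < N) u j) - limn (fun N => complex.Re (\sum_(j < N) u j))| +
  `|complex.Im (\sum_(j < N) u j) - limn (fun N => complex.Im (\sum_(j < N) u j))|)).
  by move=> N; apply: le_trans (nc_le_ReIm _) _; case: (\sum_(j < N) u j).
have to0 (x : R^nat) : cvgn x -> (fun N => `|x N - limn x|) @ \oo --> 0.
  move=> cx; rewrite -(normr0 R) -(subrr (limn x)); apply: cvg_norm.
  by apply: cvgB; [exact: cx|exact: cvg_cst].
exact: cvgn0D (to0 _ cRe) (to0 _ cIm).
Qed.

End complex_sequences.
(** * Sums of functions with summable Taylor bounds *)

Section taylor.
Variables (R : realType) (V : normedModType R[i]).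
Local Notation C := R[i].
Local Notation nc := (@Normc.normc R).

(** The norm of a module over [R[i]] takes values in [R[i]]; [nr] is the same norm as a real number,
    so that estimates stay in [R]. *)
Definition nr (v : V) : R := complex.Re `|v|.

Lemma nr_ge0 v : 0 <= nr v.
Proof. by have := normr_ge0 v; rewrite lecE /= => /andP[]. Qed.

Lemma nrE v : `|v| = (nr v)%:C.
Proof. by rewrite RRe_real ?normr_real. Qed.

(* A quantitative form of differentiability: [M] bounds the value, the
   derivative [D] and the quadratic remainder on the ball of radius [rho]. These
   bounds can be summed, which replaces Weierstrass' theorem on locally uniform
   limits of holomorphic functions. *)
Definition taylor_bound (z0 : V) (rho : R) (phi : V -> C) (M : R) :=
  exists D : V -> C,
    [/\ forall (a : C) u v, D (a *: u + v) = a * D u + D v,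
        nc (phi z0) <= M, forall h, nc (D h) <= M * nr h &
        forall h, nr h <= rho ->
          nc (phi (z0 + h) - phi z0 - D h) <= M * nr h ^+ 2].

Variables (z0 : V) (rho : R).
Implicit Types (phi psi : V -> C) (M : R).
Hypothesis rho_le1 : rho <= 1.

Lemma taylor_bound_ge0 phi M : taylor_bound z0 rho phi M -> 0 <= M.
Proof. by move=> [D [_ + _ _]]; apply: le_trans; exact: nc_ge0. Qed.

Lemma taylor_boundW phi M M' : M <= M' ->
  taylor_bound z0 rho phi M -> taylor_bound z0 rho phi M'.
Proof.
move=> MM' [D [Dl p0 Dh ph]]; exists D; split=> //.
- exact: le_trans MM'.
- by move=> h; rewrite (le_trans (Dh h))// ler_wpM2r ?nr_ge0.
- by move=> h /ph /le_trans; apply; rewrite ler_wpM2r ?exprn_ge0 ?nr_ge0.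
Qed.

(** Value, derivative and remainder contribute at most [M] each, because [nr h <= 1]. It gives
    convergence of the series on the whole ball. *)
Lemma taylor_bound_near phi M h : taylor_bound z0 rho phi M -> nr h <= rho ->
  nc (phi (z0 + h)) <= 3 * M.
Proof.
move=> phiM hrho; have M0 := taylor_bound_ge0 phiM.
case: phiM => D [_ p0 /(_ h) Dh /(_ h hrho) ph].
have h0 := nr_ge0 h; have h1 : nr h <= 1 by exact: le_trans rho_le1.
have h2 : nr h ^+ 2 <= 1 by rewrite exprn_ile1.
have := le_ncD (phi (z0 + h) - phi z0 - D h) (phi z0 + D h).
have -> : phi (z0 + h) - phi z0 - D h + (phi z0 + D h) = phi (z0 + h) by ring.
have := le_ncD (phi z0) (D h).
have : M * nr h <= M by rewrite ler_piMr.
have : M * nr h ^+ 2 <= M by rewrite ler_piMr.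
lra.
Qed.

Lemma taylor_bound_cst (c : C) : taylor_bound z0 rho (fun=> c) (nc c).
Proof.
exists (fun=> 0); split=> //.
- by move=> a _ _; rewrite mulr0 addr0.
- by move=> h; rewrite nc0 mulr_ge0 ?nc_ge0 ?nr_ge0.
- by move=> h _; rewrite subrr subr0 nc0 mulr_ge0 ?nc_ge0 ?exprn_ge0 ?nr_ge0.
Qed.

Lemma taylor_boundD phi psi M M' :
  taylor_bound z0 rho phi M -> taylor_bound z0 rho psi M' ->
  taylor_bound z0 rho (fun z => phi z + psi z) (M + M').
Proof.
move=> [D [Dl p0 Dh ph]] [D' [Dl' p0' Dh' ph']].
exists (fun h => D h + D' h); split.
- by move=> a u v; rewrite Dl Dl'; ring.
- by rewrite (le_trans (le_ncD _ _))// lerD.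
- by move=> h; rewrite mulrDl (le_trans (le_ncD _ _))// lerD.
- move=> h hrho.
  have -> : phi (z0 + h) + psi (z0 + h) - (phi z0 + psi z0) - (D h + D' h) =
    (phi (z0 + h) - phi z0 - D h) + (psi (z0 + h) - psi z0 - D' h) by ring.
  by rewrite mulrDl (le_trans (le_ncD _ _))// lerD ?ph ?ph'.
Qed.

Lemma taylor_boundZ c phi M : taylor_bound z0 rho phi M ->
  taylor_bound z0 rho (fun z => c * phi z) (nc c * M).
Proof.
move=> [D [Dl p0 Dh ph]]; exists (fun h => c * D h); split.
- by move=> a u v; rewrite Dl; ring.
- by rewrite ncM ler_wpM2l ?nc_ge0.
- by move=> h; rewrite ncM -mulrA ler_wpM2l ?nc_ge0.
- move=> h hrho; rewrite -!mulrBr ncM -mulrA ler_wpM2l ?nc_ge0//.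
  exact: ph.
Qed.

Lemma taylor_bound_sum (K : Type) (s : seq K) (phi : K -> V -> C) (M : K -> R) :
  (forall k, taylor_bound z0 rho (phi k) (M k)) ->
  taylor_bound z0 rho (fun z => \sum_(k <- s) phi k z) (\sum_(k <- s) M k).
Proof.
move=> phiM; elim: s => [|k s IH].
  have := taylor_bound_cst 0; rewrite nc0 big_nil.
  by have -> : (fun z => \sum_(k <- [::]) phi k z) = (fun=> 0);
    [apply/funext => z; rewrite big_nil|].
have := taylor_boundD (phiM k) IH; rewrite big_cons.
by congr (taylor_bound _ _ _ _); apply/funext => z; rewrite big_cons.
Qed.

(** The remainder of the product has two terms value times remainder and four products of
    derivatives and remainders. As [nr h <= 1], a remainder is also at most [M * nr h], so each of
    the six terms is at most [M * M' * nr h ^+ 2]. *)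
Lemma taylor_boundM phi psi M M' :
  taylor_bound z0 rho phi M -> taylor_bound z0 rho psi M' ->
  taylor_bound z0 rho (fun z => phi z * psi z) (6 * M * M').
Proof.
move=> phiM psiM; have M0 := taylor_bound_ge0 phiM.
have M0' := taylor_bound_ge0 psiM; have MM0 := mulr_ge0 M0 M0'.
case: phiM psiM => [D [Dl p0 Dh ph]] [D' [Dl' p0' Dh' ph']].
exists (fun h => phi z0 * D' h + psi z0 * D h); split.
- by move=> a u v; rewrite Dl Dl'; ring.
- rewrite ncM -mulrA (@le_trans _ _ (M * M'))//; last lra.
  by rewrite ler_pM ?nc_ge0.
- move=> h; have h0 := nr_ge0 h; rewrite (le_trans (le_ncD _ _))// !ncM.
  have : nc (phi z0) * nc (D' h) <= M * (M' * nr h) by rewrite ler_pM ?nc_ge0.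
  have : nc (psi z0) * nc (D h) <= M' * (M * nr h) by rewrite ler_pM ?nc_ge0.
  have : 0 <= M * M' * nr h by rewrite mulr_ge0.
  lra.
- move=> h hrho; have h0 := nr_ge0 h; have h1 : nr h <= 1 := le_trans hrho rho_le1.
  have := ph h hrho; have := ph' h hrho; have := Dh h; have := Dh' h.
  set r := phi (z0 + h) - _ - _; set r' := psi (z0 + h) - _ - _.
  have -> : phi (z0 + h) * psi (z0 + h) - phi z0 * psi z0 -
      (phi z0 * D' h + psi z0 * D h) =
    (phi z0 * r' + psi z0 * r) + (D h * D' h + D h * r') + (r * D' h + r * r').
    by rewrite /r /r'; ring.
  move: (D h) (D' h) r r' => d d' r r' d'M dM r'M rM.
  have h2 : 0 <= nr h ^+ 2 by rewrite exprn_ge0.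
  have hh : nr h ^+ 2 <= nr h by rewrite expr2 ler_piMr.
  have r'M1 : nc r' <= M' * nr h by rewrite (le_trans r'M)// ler_wpM2l.
  have rM1 : nc r <= M * nr h by rewrite (le_trans rM)// ler_wpM2l.
  apply: le_trans (le_ncD _ _) _.
  have le3 (a b c e : C) : nc (a * b + c * e) <= nc a * nc b + nc c * nc e.
    by rewrite -!ncM le_ncD.
  have := le_ncD (phi z0 * r' + psi z0 * r) (d * d' + d * r').
  have := le3 (phi z0) r' (psi z0) r; have := le3 d d' d r'.
  have := le3 r d' r r'.
  have -> : 6 * M * M' * nr h ^+ 2 = M * (M' * nr h ^+ 2) + M' * (M * nr h ^+ 2) +
    4 * ((M * nr h) * (M' * nr h)) by ring.
  have : nc (phi z0) * nc r' <= M * (M' * nr h ^+ 2) by rewrite ler_pM ?nc_ge0.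
  have : nc (psi z0) * nc r <= M' * (M * nr h ^+ 2) by rewrite ler_pM ?nc_ge0.
  have : nc d * nc d' <= M * nr h * (M' * nr h) by rewrite ler_pM ?nc_ge0.
  have : nc d * nc r' <= M * nr h * (M' * nr h) by rewrite ler_pM ?nc_ge0.
  have : nc r * nc d' <= M * nr h * (M' * nr h) by rewrite ler_pM ?nc_ge0.
  have : nc r * nc r' <= M * nr h * (M' * nr h) by rewrite ler_pM ?nc_ge0.
  lra.
Qed.

(** The derivative of the sum is the series of the derivatives [D j]; linearity and all bounds are
    inherited from the partial sums. *)
Lemma taylor_bound_series (phi : nat -> V -> C) (M : R^nat) (B : R) :
  0 <= rho -> (forall j, taylor_bound z0 rho (phi j) (M j)) ->
  (forall N, \sum_(j < N) M j <= B) ->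
  taylor_bound z0 rho (fun z => clim (fun N => \sum_(j < N) phi j z)) B.
Proof.
move=> rho0 phiM MB.
have M0 j : 0 <= M j := taylor_bound_ge0 (phiM j).
have [D DP] := choice phiM.
pose S z := clim (fun N => \sum_(j < N) phi j z).
pose DS h := clim (fun N => \sum_(j < N) D j h).
have cS h : nr h <= rho -> ccvg (fun N => \sum_(j < N) phi j (z0 + h)) (S (z0 + h)).
  move=> hrho;
  apply: (@abs_series_cvg _ (fun j => phi j (z0 + h)) (fun j => 3 * M j) (3 * B))
    => [j|N].
    exact: taylor_bound_near.
  by rewrite -mulr_sumr ler_wpM2l.
have nr0 : nr 0 = 0 by rewrite /nr normr0.
have cS0 : ccvg (fun N => \sum_(j < N) phi j z0) (S z0).
  by have := cS 0; rewrite addr0 nr0; apply.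
have cD h : ccvg (fun N => \sum_(j < N) D j h) (DS h).
  apply: (@abs_series_cvg _ (D^~ h) (fun j => M j * nr h) (B * nr h)) => [j|N].
    by have [_ _ + _] := DP j; apply.
  by rewrite -mulr_suml ler_wpM2r ?nr_ge0.
have bnd (u : nat -> C) b : (forall j, nc (u j) <= M j * b) -> 0 <= b ->
    forall N, nc (\sum_(j < N) u j) <= B * b.
  move=> uM b0 N; rewrite (le_trans (le_nc_sum _ _ _))//.
  apply: (@le_trans _ _ (\sum_(j < N) M j * b)); first by apply: ler_sum.
  by rewrite -mulr_suml ler_wpM2r.
exists DS; split.
- move=> a u v; apply: (ccvg_unique (cD (a *: u + v))).
  apply: ccvg_eq (ccvgD (ccvgZ a (cD u)) (cD v)) => N.
  rewrite mulr_sumr -big_split; apply: eq_bigr => j _.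
  by have [-> ] := DP j.
- apply: (ccvg_nc_le _ cS0) => N; rewrite -[B]mulr1.
  by apply: (bnd (phi^~ z0)) => // j; rewrite mulr1; have [] := DP j.
- move=> h; apply: (ccvg_nc_le _ (cD h)).
  by apply: (@bnd (D^~ h)); rewrite ?nr_ge0// => j; have [] := DP j.
- move=> h hrho.
  apply: (ccvg_nc_le _ (ccvgB (ccvgB (cS h hrho) cS0) (cD h))) => N.
  rewrite -!sumrB; apply: (bnd (fun j => phi j (z0 + h) - phi j z0 - D j h) (nr h ^+ 2)).
    by move=> j; have [_ _ _] := DP j; apply.
  by rewrite exprn_ge0 ?nr_ge0.
Qed.

Lemma taylor_bound_series_cvg (phi : nat -> V -> C) (M : R^nat) (B : R) :
  (forall j, taylor_bound z0 rho (phi j) (M j)) ->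
  (forall N, \sum_(j < N) M j <= B) ->
  ccvg (fun N => \sum_(j < N) phi j z0) (clim (fun N => \sum_(j < N) phi j z0)).
Proof.
move=> phiM MB; apply: (@abs_series_cvg _ (phi^~ z0) M B) => // j.
by have [D []] := phiM j.
Qed.

Lemma taylor_bound_differentiable phi M : 0 < rho ->
  taylor_bound z0 rho phi M -> differentiable (phi : V -> C^o) z0.
Proof.
move=> rho0 phiM; have M0 := taylor_bound_ge0 phiM.
case: phiM => D [Dl p0 Dh ph].
pose L : {linear V -> C^o} := HB.pack (D : V -> C^o)
  (@GRing.isLinear.Build C V C^o *:%R D (fun a u v => Dl a u v)).
have Lc : continuous L.
  apply/linear_bounded_continuous; near_simpl.
  rewrite /bounded_near; near=> K; near=> h.
  apply: (@le_trans _ _ M%:C); last first.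
    by near: K; apply: nbhs_pinfty_ge; rewrite ger0_real// ler0c.
  have h1 : nr h <= 1.
    have : `|h| < 1 by near: h; apply: nbhs0_lt.
    by rewrite nrE -[1]/(1%:C) ltcR => /ltW.
  by rewrite -[ `|_| ]/((nc (D h))%:C) lecR (le_trans (Dh h))// ler_piMr.
have E : (phi : V -> C^o) \o shift z0 = cst (phi z0) + L +o_ 0 id.
  apply/eqaddoP => e e0.
  have e_real : e = (complex.Re e)%:C by rewrite RRe_real // gtr0_real.
  have re0 : 0 < complex.Re e by rewrite -ltcR -e_real.
  near=> h; have h0 := nr_ge0 h.
  have hrho : nr h <= rho.
    have : `|h| < rho%:C by near: h; apply: nbhs0_lt; rewrite ltcR.
    by rewrite nrE ltcR => /ltW.
  (* Makes the quadratic remainder [M * nr h ^+ 2] at most [e * nr h]; [M + 1] replaces [M], which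
     may vanish. *)
  have he : nr h < complex.Re e / (M + 1).
    have : `|h| < (complex.Re e / (M + 1))%:C.
      by near: h; apply: nbhs0_lt; rewrite ltcR divr_gt0// ltr_wpDl.
    by rewrite nrE ltcR.
  rewrite e_real nrE -rmorphM.
  have -> : ((phi : V -> C^o) \o shift z0 - (cst (phi z0) + L)) h =
      phi (z0 + h) - phi z0 - D h.
    by rewrite -[LHS]/(phi (h + z0) - (phi z0 + D h)) opprD addrA (addrC h).
  rewrite -[ `|_| ]/((nc _)%:C) lecR (le_trans (ph h hrho))// expr2 mulrA.
  rewrite ler_wpM2r//; move: he; rewrite ltr_pdivlMr ?ltr_wpDl// mulrDr mulr1.
  by rewrite mulrC => he; apply: le_trans (ltW he); rewrite lerDl.
apply/diff_locallyP; split; rewrite (diff_unique Lc E)//.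
Unshelve. all: by end_near. Qed.

End taylor.

(** * Taylor bounds for complex powers *)

Section exponential_atoms.
Variables (R : realType) (V : normedModType R[i]).
Local Notation C := R[i].
Local Notation nc := (@Normc.normc R).
Local Notation nr := (@nr R V).

(** A C-linear form of norm at most 1. The coordinates of [C^2] and [w / 2] are instances, so that
    one estimate serves both one and two variables. *)
Definition short_linear (lam : V -> C) :=
  (forall (a : C) u v, lam (a *: u + v) = a * lam u + lam v) /\
  (forall h, nc (lam h) <= nr h).

Variables (lam : V -> C) (z0 : V) (rho : R).
Hypotheses (lamP : short_linear lam) (rho_gt0 : 0 < rho) (rho_le1 : rho <= 1).

Let lamD u v : lam (u + v) = lam u + lam v.
Proof. by have := lamP.1 1 u v; rewrite scale1r mul1r. Qed.

Let remainder_cexp (x : R) h :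
  cexp (lam (z0 + h) * x%:C) - cexp (lam z0 * x%:C) -
    cexp (lam z0 * x%:C) * x%:C * lam h =
  cexp (lam z0 * x%:C) * (cexp (lam h * x%:C) - 1 - lam h * x%:C).
Proof. by rewrite lamD mulrDl cexpD; ring. Qed.

Let deriv_linear (c : C) a u v :
  c * lam (a *: u + v) = a * (c * lam u) + c * lam v.
Proof. by rewrite lamP.1; ring. Qed.

Let remainder_le (x : R) h : nr h <= rho ->
  nc (cexp (lam h * x%:C) - 1 - lam h * x%:C) <=
  4 * x ^+ 2 * expR (`|x| * rho) * nr h ^+ 2.
Proof.
move=> hrho; apply: le_trans (nc_cexp_sub1_id _) _.
rewrite ncM nc_real exprMn real_normK ?num_real//.
have h0 := nr_ge0 h; have lh := lamP.2 h; have l0 := nc_ge0 (lam h).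
have l2 : nc (lam h) ^+ 2 <= nr h ^+ 2 by rewrite lerXn2r// nnegrE.
have el : expR (nc (lam h) * `|x|) <= expR (`|x| * rho).
  by rewrite ler_expR mulrC ler_wpM2l// (le_trans lh).
have -> : 4 * (nc (lam h) ^+ 2 * x ^+ 2) * expR (nc (lam h) * `|x|) =
  4 * x ^+ 2 * (nc (lam h) ^+ 2 * expR (nc (lam h) * `|x|)) by ring.
rewrite -[leRHS]mulrA; apply: ler_wpM2l; first by rewrite mulr_ge0 ?sqr_ge0.
by rewrite [leRHS]mulrC ler_pM ?expR_ge0 ?sqr_ge0.
Qed.

(** Derivative and remainder bring powers of [x], to be paid by a loss of only [2 * rho] in the
    exponent. Of the two factors [F = e^(x rho)], one bounds the exponential on the ball and the
    other absorbs [x ^+ 2] through [(x * rho) ^+ 2 <= 4 * F]; hence [16 / rho ^+ 2]. *)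
Lemma taylor_cexp (x : R) : 0 <= x ->
  taylor_bound z0 rho (fun z => cexp (lam z * x%:C))
    (16 / rho ^+ 2 * expR (x * (complex.Re (lam z0) + 2 * rho))).
Proof.
move=> x0; pose E := expR (x * complex.Re (lam z0)).
have E0 : 0 <= E := expR_ge0 _.
have ncE : nc (cexp (lam z0 * x%:C)) = E by rewrite nc_cexp Re_mulR mulrC.
pose F := expR (x * rho).
have F1 : 1 <= F by rewrite (le_trans _ (expR_ge1Dx _))// lerDl mulr_ge0// ltW.
have F0 : 0 < F := expR_gt0 _.
have -> : expR (x * (complex.Re (lam z0) + 2 * rho)) = E * (F * F).
  by rewrite -!expRD; congr expR; ring.
have xF : x * rho <= F by rewrite (le_trans _ (expR_ge1Dx _))// lerDr.
have xF2 : (x * rho) ^+ 2 <= 4 * F.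
  have h : x * rho / 2 <= expR (x * rho / 2).
    by rewrite (le_trans _ (expR_ge1Dx _))// lerDr.
  have -> : F = expR (x * rho / 2) ^+ 2.
    by rewrite -expRM_natl; congr expR; field.
  have : (x * rho / 2) ^+ 2 <= expR (x * rho / 2) ^+ 2.
    by rewrite lerXn2r// nnegrE ?expR_ge0// !mulr_ge0// ltW.
  by rewrite expr_div_n; lra.
have r2 : 0 < rho ^+ 2 by rewrite exprn_gt0.
have r21 : rho ^+ 2 <= 1 by rewrite exprn_ile1// ltW.
have FF : 1 <= F * F by rewrite -[leLHS]mulr1 ler_pM.
have k1 : 1 <= 16 / rho ^+ 2 * (F * F).
  rewrite mulrAC ler_pdivlMr// mul1r (le_trans r21)//; lra.
have k2 : x <= 16 / rho ^+ 2 * (F * F).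
  rewrite mulrAC ler_pdivlMr// expr2 mulrA.
  apply: (@le_trans _ _ (F * 1)); first by rewrite ler_pM ?mulr_ge0// ltW.
  have : F * 1 <= F * F by rewrite ler_pM2l.
  have := mulr_gt0 F0 F0; lra.
have k3 : 4 * x ^+ 2 * F <= 16 / rho ^+ 2 * (F * F).
  rewrite [leRHS]mulrA ler_pM2r// mulrAC ler_pdivlMr//.
  by move: xF2; rewrite exprMn; lra.
exists (fun h => cexp (lam z0 * x%:C) * x%:C * lam h); split.
- exact: deriv_linear.
- by rewrite ncE mulrCA ler_peMr.
- move=> h; rewrite 2!ncM ncE nc_real ger0_norm// mulrCA.
  apply: ler_pM; rewrite ?nc_ge0 ?mulr_ge0//; last exact: lamP.2.
  exact: ler_wpM2l.
- move=> h hrho; rewrite remainder_cexp ncM ncE [X in _ <= X * _]mulrCA -[leRHS]mulrA.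
  apply: ler_wpM2l => //; apply: le_trans (remainder_le _ hrho) _.
  by rewrite ger0_norm//; apply: ler_wpM2r; rewrite ?exprn_ge0 ?nr_ge0.
Qed.

(** Here the bound is proportional to [|x|] and [x] may have any sign: with [x] a difference of
    logarithms, this is the gain for neighbouring integers. *)
Lemma taylor_cexp_sub1 (x : R) :
  taylor_bound z0 rho (fun z => cexp (lam z * x%:C) - 1)
    (4 * (1 + nc (lam z0)) ^+ 2 * `|x| * expR (`|x| * (nc (lam z0) + 2))).
Proof.
set w := nc (lam z0); have w0 : 0 <= w := nc_ge0 _; have x0 := normr_ge0 x.
pose E := expR (`|x| * w); have E0 : 0 < E := expR_gt0 _.
pose F := expR `|x|; have F1 : 1 + `|x| <= F := expR_ge1Dx _.
have -> : expR (`|x| * (w + 2)) = E * (F * F).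
  by rewrite -!expRD; congr expR; ring.
have FF : F <= F * F by rewrite ler_peMr; lra.
have ncE : nc (cexp (lam z0 * x%:C)) <= E.
  rewrite nc_cexp Re_mulR ler_expR (le_trans (ler_norm _))// normrM mulrC.
  by rewrite ler_wpM2l// le_Re_nc.
exists (fun h => cexp (lam z0 * x%:C) * x%:C * lam h); split.
- exact: deriv_linear.
- apply: le_trans (nc_cexp_sub1 _) _; rewrite ncM nc_real -/w.
  have -> : w * `|x| * (1 + 4 * (w * `|x|)) * expR (w * `|x|) =
    `|x| * (w * (1 + 4 * (w * `|x|))) * E by rewrite /E (mulrC w); ring.
  have -> : 4 * (1 + w) ^+ 2 * `|x| * (E * (F * F)) =
    `|x| * (4 * (1 + w) ^+ 2 * (F * F)) * E by ring.
  rewrite ler_wpM2r ?ler_wpM2l//; first exact: ltW.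
  apply: (@le_trans _ _ (4 * (1 + w) ^+ 2 * (1 + `|x|))); last first.
    by rewrite ler_wpM2l ?mulr_ge0 ?sqr_ge0//; lra.
  by have := mulr_ge0 w0 x0; have := mulr_ge0 w0 w0; nra.
- move=> h; rewrite 2!ncM nc_real.
  have h0 := nr_ge0 h; have lh := lamP.2 h.
  apply: (@le_trans _ _ (E * `|x| * nr h)); first by rewrite !ler_pM ?nc_ge0 ?mulr_ge0 ?nc_ge0.
  rewrite ler_wpM2r//.
  have -> : 4 * (1 + w) ^+ 2 * `|x| * (E * (F * F)) =
    (E * `|x|) * (4 * (1 + w) ^+ 2 * (F * F)) by ring.
  rewrite ler_peMr ?mulr_ge0//; first exact: ltW.
  have : 1 <= 4 * (1 + w) ^+ 2 by nra.
  have : 1 <= F * F by lra.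
  by move=> a b; rewrite -[leLHS]mulr1 ler_pM.
- move=> h hrho.
  have -> : cexp (lam (z0 + h) * x%:C) - 1 - (cexp (lam z0 * x%:C) - 1) =
    cexp (lam (z0 + h) * x%:C) - cexp (lam z0 * x%:C) by ring.
  rewrite remainder_cexp ncM; have h0 := nr_ge0 h.
  apply: (@le_trans _ _ (E * (4 * x ^+ 2 * F * nr h ^+ 2))).
    apply: ler_pM; rewrite ?nc_ge0//; apply: le_trans (remainder_le _ hrho) _.
    apply: ler_wpM2r; first by rewrite exprn_ge0.
    apply: ler_wpM2l; first by rewrite mulr_ge0 ?sqr_ge0.
    by rewrite ler_expR ler_piMr.
  rewrite mulrA; apply: ler_wpM2r; first by rewrite exprn_ge0.
  rewrite -(real_normK (num_real x)).
  have -> : 4 * (1 + w) ^+ 2 * `|x| * (E * (F * F)) =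
    E * (4 * `|x| * F * ((1 + w) ^+ 2 * F)) by ring.
  have -> : E * (4 * `|x| ^+ 2 * F) = E * (4 * `|x| * F * `|x|) by ring.
  apply: ler_wpM2l; first exact: ltW.
  apply: ler_wpM2l; first by rewrite !mulr_ge0 ?expR_ge0.
  apply: (@le_trans _ _ (1 * F)); first lra.
  by apply: ler_wpM2r; rewrite ?expR_ge0//; nra.
Qed.

(* [cexp (w * (ln x)%:C)] is the power [x ^ w]. *)
Lemma taylor_pow_diff (x y b : R) : 0 <= y -> `|x - y| <= b ->
  taylor_bound z0 rho (fun z => cexp (lam z * x%:C) - cexp (lam z * y%:C))
    (6 * (16 / rho ^+ 2) * (4 * (1 + nc (lam z0)) ^+ 2) * `|x - y| *
     expR (b * (nc (lam z0) + 2)) *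
     expR (y * (complex.Re (lam z0) + 2 * rho))).
Proof.
move=> y0 xyb.
(* With [x] and [y] as logarithms, [e^(lam x) - e^(lam y) = e^(lam y) (e^(lam (x - y)) - 1)]. *)
have := taylor_boundM rho_le1 (taylor_cexp y0) (taylor_cexp_sub1 (x - y)).
have -> : (fun z => cexp (lam z * y%:C) * (cexp (lam z * (x - y)%:C) - 1)) =
    (fun z => cexp (lam z * x%:C) - cexp (lam z * y%:C)).
  apply/funext => z; rewrite mulrBr mulr1 -cexpD -mulrDr -rmorphD /=.
  by rewrite (addrC y) subrK.
apply: taylor_boundW.
set E := expR (y * _).
have -> : 6 * (16 / rho ^+ 2 * E) * (4 * (1 + nc (lam z0)) ^+ 2 * `|x - y| *
   expR (`|x - y| * (nc (lam z0) + 2))) =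
   6 * (16 / rho ^+ 2) * (4 * (1 + nc (lam z0)) ^+ 2) * `|x - y| *
   expR (`|x - y| * (nc (lam z0) + 2)) * E by ring.
apply: ler_wpM2r; rewrite ?expR_ge0//; apply: ler_wpM2l.
  have r0 : 0 <= 16 / rho ^+ 2 by rewrite divr_ge0 ?sqr_ge0.
  have w0 : 0 <= 4 * (1 + nc (lam z0)) ^+ 2 by rewrite mulr_ge0 ?sqr_ge0.
  by apply: mulr_ge0 => //; apply: mulr_ge0 => //; apply: mulr_ge0.
by rewrite ler_expR ler_wpM2r// addr_ge0 ?nc_ge0.
Qed.

End exponential_atoms.
(** * Gaussian sums *)

Section real_estimates.
Variable R : realType.
Implicit Types (x y t W : R) (N m n k : nat).

Lemma expRN1_le_half : expR (-1) <= 1 / 2 :> R.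
Proof.
rewrite expRN mul1r lef_pV2 ?posrE ?expR_gt0//.
by rewrite (le_trans _ (expR_ge1Dx 1)).
Qed.

(** A discrete integral test: [e * (n+2)^(-1-e)] is at most the increment [(n+1)^(-e) - (n+2)^(-e)],
    which telescopes. The comparison comes from [ln (n+1) <= ln (n+2) - 1 / (n+2)]. *)
Lemma pseries_le (e : R) N : 0 < e ->
  \sum_(j < N) expR (- (1 + e) * ln j.+1%:R) <= 1 + e^-1.
Proof.
move=> e0.
suff H n : e * \sum_(j < n) expR (- (1 + e) * ln j.+2%:R) <=
    1 - expR (- e * ln n.+1%:R).
  case: N => [|N]; first by rewrite big_ord0 addr_ge0// invr_ge0 ltW.
  rewrite big_ord_recl /= ln1 mulr0 expR0 lerD2l -[leRHS]mulr1.
  rewrite -ler_pdivrMl ?invr_gt0// invrK.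
  by apply: le_trans (H N) _; rewrite gerBl expR_ge0.
elim: n => [|n IH]; first by rewrite big_ord0 ln1 !mulr0 expR0 subrr.
rewrite big_ord_recr /= mulrDr; set s := e * _ in IH *.
suff : e * expR (- (1 + e) * ln n.+2%:R) <=
    expR (- e * ln n.+1%:R) - expR (- e * ln n.+2%:R) by lra.
have lnE : ln (n.+1%:R : R) <= ln n.+2%:R - n.+2%:R^-1.
  have -> : n.+1%:R = n.+2%:R * (1 + - n.+2%:R^-1) :> R.
    by rewrite mulrDr mulr1 mulrN divff// -[in RHS]natr1 addrK.
  have h : -1 < - n.+2%:R^-1 :> R by rewrite ltrN2 invf_lt1// ltr1n.
  have h' : 0 < 1 + - n.+2%:R^-1 :> R by rewrite -(subrr 1) ltrD2l.
  by rewrite lnM ?posrE// lerD2l le_ln1Dx.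
set a := ln n.+2%:R in lnE *; set b := ln n.+1%:R in lnE *.
have -> : - (1 + e) * a = - e * a - a by ring.
rewrite expRB lnK ?posrE//.
have -> : expR (- e * b) = expR (- e * a) * expR (e * (a - b)).
  by rewrite -expRD; congr expR; ring.
move: n.+2%:R^-1 lnE => c lnE.
have h1 : 1 + e * c <= expR (e * (a - b)).
  apply: le_trans (expR_ge1Dx _); rewrite lerD2l ler_wpM2l//; first exact: ltW.
  lra.
have := expR_gt0 (- e * a); set E := expR _ => E0.
have : E * (1 + e * c) <= E * expR (e * (a - b)) by rewrite ler_pM2l.
lra.
Qed.

(** Completing the square with [W + 1] in place of [W]: the Gaussian absorbs the growth [e^(x W)]
    and still leaves the decay [e^(-x)]. *)
Lemma gauss_le t W x : 0 < t ->
  expR (- t * x ^+ 2 + x * W) <= expR ((W + 1) ^+ 2 / (4 * t)) * expR (- x).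
Proof.
move=> t0; rewrite -expRD ler_expR.
have -> : (W + 1) ^+ 2 / (4 * t) + - x =
    - t * x ^+ 2 + x * W + t * (x - (W + 1) / (2 * t)) ^+ 2.
  by field; rewrite gt_eqF.
by rewrite lerDl mulr_ge0 ?sqr_ge0// ltW.
Qed.

(** As [e^(-1) <= 1/2], both sides of [m] are dominated by geometric series. The inductions carry
    the sharper bounds [e^(-(m - N))] up to [m] and [4 - 2 e^(-(N - m))] beyond it. *)
Lemma sum_expRN_dist_le m N : \sum_(n < N) expR (- `|n%:R - m%:R|) <= 4 :> R.
Proof.
have half x : expR (- x - 1) <= expR (- x) / 2.
  by rewrite expRD ler_pM2l ?expR_gt0// (le_trans expRN1_le_half)// mul1r.
have [Nm|mN] := leqP N m.
  suff : \sum_(n < N) expR (- `|n%:R - m%:R|) <= expR (- (m%:R - N%:R)) :> R.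
    move/le_trans; apply; apply: (@le_trans _ _ 1); last lra.
    by rewrite expR_le1 oppr_le0 subr_ge0 ler_nat.
  elim: N Nm => [|N IH] Nm; first by rewrite big_ord0 expR_ge0.
  rewrite big_ord_recr /= ler0_norm ?subr_le0 ?ler_nat ?(ltnW Nm)// opprB.
  have := IH (ltnW Nm); have := half (m%:R - N.+1%:R).
  have -> : - (m%:R - N.+1%:R) - 1 = - (m%:R - N%:R) :> R.
    by rewrite -[N.+1%:R]natr1; ring.
  lra.
suff : \sum_(n < N) expR (- `|n%:R - m%:R|) <=
    4 - 2 * expR (- (N%:R - m%:R)) :> R.
  by move/le_trans; apply; rewrite gerBl mulr_ge0 ?expR_ge0.
rewrite -(subnKC (ltnW mN)); elim: (N - m)%N => [|k IH].
  rewrite addn0 subrr oppr0 expR0.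
  suff : \sum_(n < m) expR (- `|n%:R - m%:R|) <= 1 :> R by lra.
  suff H n : (n <= m)%N ->
      \sum_(n < n) expR (- `|n%:R - m%:R|) <= expR (- (m%:R - n%:R)) :> R.
    by have := H m (leqnn m); rewrite subrr oppr0 expR0.
  elim: n => [|n IH] nm; first by rewrite big_ord0 expR_ge0.
  rewrite big_ord_recr /= ler0_norm ?subr_le0 ?ler_nat ?(ltnW nm)// opprB.
  have := IH (ltnW nm); have := half (m%:R - n.+1%:R).
  have -> : - (m%:R - n.+1%:R) - 1 = - (m%:R - n%:R) :> R.
    by rewrite -[n.+1%:R]natr1; ring.
  lra.
rewrite addnS big_ord_recr /= ger0_norm ?subr_ge0 ?ler_nat ?leq_addr//.
have := half ((m + k)%:R - m%:R).
have -> : - ((m + k)%:R - m%:R) - 1 = - ((m + k).+1%:R - m%:R) :> R.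
  by rewrite -[(m + k).+1%:R]natr1; ring.
lra.
Qed.

Lemma lnB_le x y : 0 < x -> 0 < y -> ln x - ln y <= (x - y) / y.
Proof.
move=> x0 y0; have -> : x = y * (1 + (x - y) / y) by field; rewrite gt_eqF.
have h : -1 < (x - y) / y by rewrite ltr_pdivlMr//; lra.
have h' : 0 < 1 + (x - y) / y by lra.
rewrite lnM ?posrE// addrAC subrr add0r; apply: le_trans (le_ln1Dx h) _.
by have -> : y * (1 + (x - y) / y) - y = x - y by field; rewrite gt_eqF.
Qed.

Lemma abs_lnB_le x y : 1 <= x -> 1 <= y ->
  `|ln x - ln y| <= `|x - y|.
Proof.
move=> x1 y1; have x0 : 0 < x by lra. have y0 : 0 < y by lra.
have h (a b : R) : 0 < a -> 1 <= b -> b <= a -> ln a - ln b <= a - b.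
  move=> a0 b1 ab; have b0 : 0 < b by lra.
  by apply: le_trans (lnB_le a0 b0) _; rewrite ler_pdivrMr ?ler_peMr//; lra.
have [xy|yx] := leP x y.
  rewrite (ler0_norm (_ : x - y <= 0)); last lra.
  by rewrite ler0_norm ?opprB ?h// subr_le0 ler_ln ?posrE.
rewrite (gtr0_norm (_ : 0 < x - y)); last lra.
by rewrite ger0_norm ?h ?subr_ge0 ?ler_ln ?posrE// ltW.
Qed.

(** The decay has to sit in the fixed variable [y] even when [x < y]; then [y / x <= 1 + |x - y|],
    since [x >= 1]. The exponential loss in [|x - y|] is harmless against the Gaussian weight. *)
Lemma abs_lnB_le_expR x y : 1 <= x -> 1 <= y ->
  `|ln x - ln y| <= expR (2 * `|x - y|) / y.
Proof.
move=> x1 y1; have x0 : 0 < x by lra. have y0 : 0 < y by lra.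
set k := `|x - y|; have k0 : 0 <= k by exact: normr_ge0.
apply: (@le_trans _ _ (k * (1 + k) / y)); last first.
  rewrite ler_pM2r ?invr_gt0// mulrDl mul1r expRD ler_pM//; first lra.
    by rewrite (le_trans _ (expR_ge1Dx _))// lerDr.
  exact: expR_ge1Dx.
have [xy|yx] := leP x y.
  have kE : k = y - x by rewrite /k ler0_norm ?opprB//; lra.
  rewrite ler0_norm ?opprB ?subr_le0 ?ler_ln ?posrE//.
  apply: le_trans (lnB_le y0 x0) _; rewrite -kE ler_pdivrMr// mulrAC ler_pdivlMr//.
  by rewrite -mulrA ler_wpM2l// kE; nra.
have kE : k = x - y by rewrite /k ger0_norm//; lra.
rewrite ger0_norm ?subr_ge0 ?ler_ln ?posrE ?(ltW yx)//.
apply: le_trans (lnB_le x0 y0) _; rewrite -kE ler_pM2r ?invr_gt0//.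
by rewrite ler_peMr//; lra.
Qed.

End real_estimates.

(** * The sums [theta] and [kappa] and their behaviour as [t] tends to 0 *)

Section theta_sums.
Variable R : realType.
Implicit Types (x : R) (N m n k : nat).

Lemma cvgn_eq (u v : R^nat) (l : R) : u =1 v -> u @ \oo --> l -> v @ \oo --> l.
Proof. by move=> /funext ->. Qed.

Lemma nsumP (u : nat -> R) (l : R) :
  (fun N => \sum_(j < N) u j.+1) @ \oo --> l -> nsum u = l.
Proof.
move=> ul; apply: cvg_lim => //; rewrite -cvg_shiftS.
apply: cvg_trans ul; apply: near_eq_cvg; apply: nearW => N /=.
by rewrite big_add1 big_mkord.
Qed.

Lemma nsum_cvg (u : nat -> R) (B : R) : (forall j, 0 <= u j.+1) ->
  (forall N, \sum_(j < N) u j.+1 <= B) ->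
  (fun N => \sum_(j < N) u j.+1) @ \oo --> nsum u.
Proof.
move=> u0 uB; have := bounded_series_cvg u0 uB; move=> /cvgP.
have -> : series (fun j => u j.+1) = (fun N => \sum_(j < N) u j.+1).
  by apply/funext => N; rewrite /series/= big_mkord.
by move=> /cvg_ex[l ul]; rewrite (nsumP ul).
Qed.

Lemma cvgn_expRN (c : R) :
  (fun N => c * expR (- N%:R)) @ \oo --> (0 : R).
Proof. by rewrite -(mulr0 c); apply: cvgMr; exact: cvgn_expR. Qed.

Lemma mul_expRN_le n : n%:R ^+ 2 * expR (- n%:R) <= 4 :> R.
Proof.
have h : n%:R / 2 <= expR (n%:R / 2) :> R.
  by rewrite (le_trans _ (expR_ge1Dx _))// lerDr.
have : (n%:R / 2) ^+ 2 <= expR (n%:R / 2) ^+ 2 :> R.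
  by rewrite lerXn2r// nnegrE ?expR_ge0// divr_ge0.
rewrite -expRM_natl mulrCA divff// mulr1 expr_div_n => h2.
by rewrite expRN ler_pdivrMr ?expR_gt0//; lra.
Qed.

Lemma cvgn_invS (c : R) : (fun N => c / N.+1%:R) @ \oo --> (0 : R).
Proof. by rewrite -(mulr0 c); apply: cvgMr; exact: cvg_harmonic. Qed.

Variable t : R.
Hypothesis t_gt0 : 0 < t.

Definition gauss k : R := expR (- t * k%:R ^+ 2).

Definition theta : R := nsum gauss.

Definition kappa : R := nsum (fun k => k%:R * gauss k).

(** The sum of [gauss k] over [k > m]. In the later series the index [m] stands for the integer
    [m + 1], so this is the tail [T_(m+1)] of the overview. *)
Definition gauss_tail m : R := theta - \sum_(j < m) gauss j.+1.

Lemma gauss_ge0 k : 0 <= gauss k.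
Proof. exact: expR_ge0. Qed.

Lemma gauss0 : gauss 0 = 1.
Proof. by rewrite /gauss expr0n mulr0 expR0. Qed.

Let c0 := expR ((0 + 1) ^+ 2 / (4 * t)).
Let c1 := expR ((1 + 1) ^+ 2 / (4 * t)).

Lemma gauss_expRN k : gauss k <= c0 * expR (- k%:R).
Proof. by have := gauss_le 0 k%:R t_gt0; rewrite mulr0 addr0. Qed.

Lemma mul_gauss_expRN k : k%:R * gauss k <= c1 * expR (- k%:R).
Proof.
apply: le_trans (gauss_le 1 k%:R t_gt0); rewrite mulr1 expRD mulrC.
by rewrite ler_wpM2l ?gauss_ge0// (le_trans _ (expR_ge1Dx _))// lerDr.
Qed.

Lemma sum_expRN_le (f : nat -> R) (c : R) N : 0 <= c ->
  (forall j, f j <= c * expR (- j%:R)) -> \sum_(j < N) f j <= c * 4.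
Proof.
move=> cge0 fc; apply: (@le_trans _ _ (\sum_(j < N) c * expR (- j%:R))).
  by apply: ler_sum.
rewrite -mulr_sumr ler_wpM2l//; apply: le_trans (sum_expRN_dist_le R 0 N).
by apply: ler_sum => j _; rewrite subr0 ger0_norm.
Qed.

Let expRNS_le (c : R) k : 0 <= c -> c * expR (- k.+1%:R) <= c * expR (- k%:R).
Proof. by move=> cge0; rewrite ler_wpM2l// ler_expR lerN2 ler_nat. Qed.

Lemma theta_cvg : (fun N => \sum_(j < N) gauss j.+1) @ \oo --> theta.
Proof.
apply: (@nsum_cvg _ (c0 * 4)) => [j|N]; first exact: gauss_ge0.
apply: (@sum_expRN_le (fun j => gauss j.+1)) => [|j]; first exact: expR_ge0.
by apply: le_trans (gauss_expRN _) _; apply: expRNS_le; exact: expR_ge0.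
Qed.

Lemma kappa_cvg :
  (fun N => \sum_(j < N) j.+1%:R * gauss j.+1) @ \oo --> kappa.
Proof.
apply: (@nsum_cvg (fun k => k%:R * gauss k) (c1 * 4)) => [j|N].
  by rewrite mulr_ge0 ?gauss_ge0.
apply: (@sum_expRN_le (fun j => j.+1%:R * gauss j.+1)) => [|j]; first exact: expR_ge0.
by apply: le_trans (mul_gauss_expRN _) _; apply: expRNS_le; exact: expR_ge0.
Qed.

Lemma nsum_plus : nsum (fun k => (k%:R + 1) * gauss k) = kappa + theta.
Proof.
apply: nsumP; apply: (cvgn_eq _ (cvgD kappa_cvg theta_cvg)) => N.
rewrite -[LHS]/(_ + _) -big_split.
by apply: eq_bigr => j _; rewrite mulrDl mul1r.
Qed.

Lemma nsum_minus : nsum (fun k => (k%:R - 1) * gauss k) = kappa - theta.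
Proof.
apply: nsumP; apply: (cvgn_eq _ (cvgB kappa_cvg theta_cvg)) => N.
rewrite -[LHS]/(_ - _) -sumrB.
by apply: eq_bigr => j _; rewrite mulrBl mul1r.
Qed.

Lemma partial_theta_le N : \sum_(j < N) gauss j.+1 <= theta.
Proof.
rewrite -(cvg_lim _ theta_cvg)//; apply: limr_ge; first exact: cvgP theta_cvg.
near=> n; have Nn : (N <= n)%N by near: n; exact: nbhs_infty_ge.
rewrite -(subnKC Nn) big_split_ord /= lerDl sumr_ge0// => j _.
exact: gauss_ge0.
Unshelve. all: by end_near. Qed.

Lemma partial_kappa_le N : \sum_(j < N) j.+1%:R * gauss j.+1 <= kappa.
Proof.
rewrite -(cvg_lim _ kappa_cvg)//; apply: limr_ge; first exact: cvgP kappa_cvg.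
near=> n; have Nn : (N <= n)%N by near: n; exact: nbhs_infty_ge.
rewrite -(subnKC Nn) big_split_ord /= lerDl sumr_ge0// => j _.
by rewrite mulr_ge0 ?gauss_ge0.
Unshelve. all: by end_near. Qed.

Lemma gauss_tail_ge0 m : 0 <= gauss_tail m.
Proof. by rewrite subr_ge0 partial_theta_le. Qed.

Lemma gauss_tail_le m : gauss_tail m <= c0 * 4 * expR (- m%:R).
Proof.
rewrite lerBlDl -(cvg_lim _ theta_cvg)//.
apply: limr_le; first exact: cvgP theta_cvg.
near=> n; have mn : (m <= n)%N by near: n; exact: nbhs_infty_ge.
rewrite -(subnKC mn) big_split_ord /= lerD2l.
rewrite mulrAC; apply: (@sum_expRN_le (fun j => gauss (m + j).+1)) => [|j].
  by rewrite mulr_ge0 ?expR_ge0.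
apply: le_trans (gauss_expRN _) _; rewrite -mulrA -expRD ler_wpM2l ?expR_ge0//.
by rewrite ler_expR -opprD lerN2 -natrD ler_nat.
Unshelve. all: by end_near. Qed.

(** Abel summation: [gauss k] occurs in the [k] tails with [m < k]. The boundary term
    [N * gauss_tail N] vanishes by the exponential bound on the tails. *)
Lemma gauss_tail_cvg : (fun N => \sum_(m < N) gauss_tail m) @ \oo --> kappa.
Proof.
have E N : \sum_(m < N) gauss_tail m =
    \sum_(j < N) j.+1%:R * gauss j.+1 + N%:R * gauss_tail N.
  elim: N => [|N IH]; first by rewrite !big_ord0 mul0r addr0.
  have -> : gauss_tail N.+1 = gauss_tail N - gauss N.+1.
    by rewrite /gauss_tail big_ord_recr /= opprD addrA.
  by rewrite !big_ord_recr /= IH -[N.+1%:R]natr1; ring.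
have lim0 : (fun N => N%:R * gauss_tail N) @ \oo --> (0 : R).
  rewrite -(cvg_shiftS (fun N => N%:R * gauss_tail N)).
  apply: (@squeeze_cvgr _ _ _ _ (fun=> 0) (fun N => c0 * 16 / N.+1%:R)).
  - apply: nearW => N; rewrite mulr_ge0 ?gauss_tail_ge0//=.
    rewrite ler_pdivlMr// mulrAC -expr2.
    apply: (@le_trans _ _ (N.+1%:R ^+ 2 * (c0 * 4 * expR (- N.+1%:R)))).
      by rewrite ler_wpM2l ?sqr_ge0// gauss_tail_le.
    have := mul_expRN_le N.+1; have : 0 <= c0 by exact: expR_ge0.
    move: (expR _) (N.+1%:R ^+ 2) => e s c0ge0 h.
    have -> : s * (c0 * 4 * e) = c0 * 4 * (s * e) by ring.
    have -> : c0 * 16 = c0 * 4 * 4 by ring.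
    by rewrite ler_wpM2l ?mulr_ge0.
  - exact: cvg_cst.
  - exact: cvgn_invS.
rewrite -(addr0 kappa); apply: (cvgn_eq _ (cvgD kappa_cvg lim0)) => N.
by rewrite E.
Qed.

Lemma gaussS k : gauss k.+1 = gauss k * expR (- (t * (2 * k%:R + 1))).
Proof.
rewrite /gauss -expRD; congr expR; rewrite -[k.+1%:R]natr1; ring.
Qed.

(** The increments [gauss k - gauss k.+1] telescope to [gauss 0 = 1], and [e^(-x) >= 1 - x] bounds
    each by [t (2k + 1) gauss k]. *)
Lemma theta_kappa_lower : 1 <= t * (1 + 2 * kappa + theta).
Proof.
have H N : 1 - gauss N.+1 <= t * (1 + 2 * kappa + theta).
  apply: (@le_trans _ _ (t * (1 + 2 * (\sum_(j < N) j.+1%:R * gauss j.+1) +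
      \sum_(j < N) gauss j.+1))); last first.
    rewrite ler_pM2l// lerD ?partial_theta_le// lerD2l ler_pM2l//.
    exact: partial_kappa_le.
  have step k : gauss k - gauss k.+1 <= t * (2 * k%:R + 1) * gauss k.
    rewrite gaussS; set x := t * (2 * k%:R + 1).
    have := expR_ge1Dx (- x); have := gauss_ge0 k.
    move: (expR (- x)) (gauss k) => e g g0 h.
    have : g * (1 + - x) <= g * e by rewrite ler_wpM2l.
    lra.
  elim: N => [|N IH].
    rewrite !big_ord0; have := step 0%N.
    by rewrite gauss0; lra.
  rewrite !big_ord_recr /=; have := step N.+1; move: IH; lra.
have : (fun N => 1 - gauss N.+1) @ \oo --> (1 - 0 : R).
  apply: cvgB; first exact: cvg_cst.
  apply: (@squeeze_cvgr _ _ _ _ (fun=> 0) (fun N => c0 * expR (- N%:R))).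
  - apply: nearW => N; rewrite gauss_ge0/=.
    by apply: le_trans (gauss_expRN _) _; apply: expRNS_le; exact: expR_ge0.
  - exact: cvg_cst.
  - exact: cvgn_expRN.
rewrite subr0 => l1; rewrite -[leLHS](cvg_lim _ l1)//.
by apply: limr_le; [exact: cvgP l1|exact: nearW].
Qed.

(** The same increments seen from their right end: [e^x >= 1 + x] for the ratio
    [gauss k / gauss k.+1] gives a lower bound in terms of [gauss k.+1]. *)
Lemma theta_kappa_upper : t * (2 * kappa - theta) <= 1.
Proof.
have H N : t * (2 * (\sum_(j < N) j.+1%:R * gauss j.+1) -
      \sum_(j < N) gauss j.+1) <= 1 - gauss N.
  have step k : t * (2 * k.+1%:R - 1) * gauss k.+1 <= gauss k - gauss k.+1.
    have -> : gauss k = gauss k.+1 * expR (t * (2 * k%:R + 1)).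
      by rewrite gaussS -mulrA -expRD addNr expR0 mulr1.
    have -> : 2 * k.+1%:R - 1 = 2 * k%:R + 1 :> R.
      by rewrite -[k.+1%:R]natr1; ring.
    set x := t * (2 * k%:R + 1).
    have := expR_ge1Dx x; have := gauss_ge0 k.+1.
    move: (expR x) (gauss k.+1) => e g g0 h.
    have : g * (1 + x) <= g * e by rewrite ler_wpM2l.
    lra.
  elim: N => [|N IH].
    by rewrite !big_ord0 gauss0; lra.
  rewrite !big_ord_recr /=; have := step N; move: IH; lra.
have l1 : (fun N => t * (2 * (\sum_(j < N) j.+1%:R * gauss j.+1) -
      \sum_(j < N) gauss j.+1)) @ \oo --> t * (2 * kappa - theta).
  apply: cvgMr; apply: cvgB; last exact: theta_cvg.
  by apply: cvgMr; exact: kappa_cvg.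
rewrite -[leLHS](cvg_lim _ l1)//.
apply: limr_le; first exact: cvgP l1.
by apply: nearW => N; apply: le_trans (H N) _; rewrite gerBl gauss_ge0.
Qed.

(** Cut the sum at [n = N + 1]: the first [n] terms are at most 1, and beyond them
    [gauss k <= k * gauss k / n]. Thus [theta <= n + kappa / n], and [theta_kappa_upper] eliminates
    [kappa]. No Gaussian integral is involved. *)
Lemma theta_le N : t * theta <= 2 * t * N.+1%:R + N.+1%:R^-1.
Proof.
set n : R := N.+1%:R; have n1 : 1 <= n by rewrite /n ler1n.
have n0 : 0 < n by lra.
have H K : \sum_(j < K) gauss j.+1 <= n + kappa / n.
  apply: (@le_trans _ _ (n + (\sum_(j < K) j.+1%:R * gauss j.+1) / n)); last first.
    by rewrite lerD2l ler_pM2r ?invr_gt0// partial_kappa_le.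
  apply: (@le_trans _ _ (\sum_(j < K) (j < N.+1)%:R +
    (\sum_(j < K) j.+1%:R * gauss j.+1) / n)).
    rewrite mulr_suml -big_split /=; apply: ler_sum => j _.
    have g0 := gauss_ge0 j.+1.
    have g1 : gauss j.+1 <= 1.
      by rewrite expR_le1 mulNr oppr_le0 mulr_ge0 ?sqr_ge0// ltW.
    have [jN|Nj] := ltnP j N.+1.
      by rewrite (le_trans g1)// lerDl divr_ge0 ?mulr_ge0// ltW.
    rewrite add0r ler_pdivlMr// mulrC ler_wpM2r// ler_nat.
    exact: leq_trans Nj _.
  rewrite lerD2r; elim: K => [|K IH]; first by rewrite big_ord0 ltW.
  rewrite big_ord_recr /=; have [KN|NK] := ltnP K N.+1; last by rewrite addr0.
  apply: (@le_trans _ _ K.+1%:R); last by rewrite ler_nat.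
  rewrite -[K.+1%:R]natr1 lerD2r; apply: (@le_trans _ _ (\sum_(j < K) 1)).
    by apply: ler_sum => j _; rewrite lern1 leq_b1.
  by rewrite sumr_const card_ord.
have : theta <= n + kappa / n.
  rewrite -(cvg_lim _ theta_cvg)//.
  by apply: limr_le; [exact: cvgP theta_cvg|exact: nearW].
have := theta_kappa_upper; have th0 : 0 <= theta.
  by have := gauss_tail_ge0 0; rewrite /gauss_tail big_ord0 subr0.
move=> up th.
have tk : 2 * (t * kappa) <= 1 + t * theta by lra.
have : n * (t * theta) <= t * n ^+ 2 + t * kappa.
  have -> : t * n ^+ 2 + t * kappa = n * (t * (n + kappa / n)).
    by field; rewrite gt_eqF.
  by rewrite ler_pM2l// ler_pM2l.
have tth : 0 <= t * theta by rewrite mulr_ge0// ltW.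
move=> h; rewrite -(ler_pM2l n0).
have -> : n * (2 * t * n + n^-1) = 2 * t * n ^+ 2 + 1 by field; rewrite gt_eqF.
have : t * theta <= n * (t * theta) by rewrite ler_peMl.
lra.
Qed.

End theta_sums.

Lemma heat_trace_limit (R : realType) :
  (fun t : R => 4 * pi * t * (1 / 2 - (kappa t - theta t))) @ 0^'+ --> - (2 * pi).
Proof.
have th0 : (fun t => t * theta t) @ 0^'+ --> (0 : R).
  apply/cvgrPdist_le => e e0.
  (* [N] is fixed first, to make [1 / (N + 1)] at most [e / 2]; the other half of [e] is then
     obtained from [t]. *)
  pose N := Num.truncn (2 / e).
  have Ne : N.+1%:R^-1 <= e / 2.
    rewrite -[e / 2]invrK lef_pV2 ?posrE ?invr_gt0 ?divr_gt0// invf_div.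
    by rewrite ltW// truncnS_gt.
  near=> t; have t0 : 0 < t by near: t; exact: nbhs_right_gt.
  have tN : t < e / (4 * N.+1%:R).
    by near: t; apply: nbhs_right_lt; rewrite divr_gt0// mulr_gt0.
  have th : 0 <= theta t.
    by have := gauss_tail_ge0 t0 0; rewrite /gauss_tail big_ord0 subr0.
  rewrite sub0r normrN ger0_norm ?mulr_ge0 ?(ltW t0)//.
  apply: le_trans (theta_le t0 N) _.
  move: tN; rewrite ltr_pdivlMr ?mulr_gt0//.
  have arith (i n : R) : i <= e / 2 -> t * (4 * n) < e -> 2 * t * n + i <= e by lra.
  exact: arith.
apply/cvgrPdist_le => e e0; have p0 := pi_gt0 R.
have q0 : 0 < 16 * pi :> R by rewrite mulr_gt0.
(* The error will be at most [4 pi t + 6 pi t theta], so [t] and [t theta] below [e / (16 pi)] give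
   [5 e / 8]. *)
have d0 : 0 < e / (16 * pi) by rewrite divr_gt0.
move/cvgrPdist_le : th0 => /(_ _ d0) th1.
near=> t; have t0 : 0 < t by near: t; exact: nbhs_right_gt.
have te : t <= e / (16 * pi) by near: t; exact: nbhs_right_le.
have : `|0 - t * theta t| <= e / (16 * pi).
  by near: t; exact: th1.
rewrite sub0r normrN => /(le_trans (ler_norm _)) the.
have te' : t * (16 * pi) <= e by rewrite -ler_pdivlMr.
have the' : t * theta t * (16 * pi) <= e by rewrite -ler_pdivlMr.
have := theta_kappa_lower t0; have := theta_kappa_upper t0.
set k := kappa t; set h := theta t => up lo.
have E : - (2 * pi) - 4 * pi * t * (1 / 2 - (k - h)) =
  2 * pi * (2 * (t * k) - 1 - t - 2 * (t * h)) by field.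
rewrite E; have pp : 0 <= 2 * pi :> R by rewrite mulr_ge0 ?ltW.
have th : 0 <= t * h.
  apply: mulr_ge0; first exact: ltW.
  by have := gauss_tail_ge0 t0 0; rewrite /gauss_tail big_ord0 subr0.
rewrite normrM (ger0_norm pp); apply: (@le_trans _ _ (2 * pi * (2 * t + 3 * (t * h)))).
  by apply: ler_wpM2l => //; rewrite ler_norml; apply/andP; split; lra.
move: te' the'; rewrite -/h; lra.
Unshelve. all: by end_near. Qed.
(** * Analytic continuation of the double series *)

Section analytic_sums.
Variable R : realType.
Local Notation C := R[i].
Local Notation nc := (@Normc.normc R).
Local Notation rho := (16^-1 : R).

Let rho_gt0 : 0 < rho. Proof. by rewrite invr_gt0. Qed.
Let rho_le1 : rho <= 1. Proof. by rewrite invf_le1// ler1n. Qed.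

(** The difference of logarithms gains [1 / y], while the ball costs [2 * rho = 1/8]: the net
    exponent is [c - 7/8]. The losses [e^(2b)] and [e^(b (w + 2))], with [w = nc (lam z0)], combine
    into [e^(b (w + 4))]. *)
Lemma taylor_natpow_diff (V : normedModType C) (lam : V -> C) (z0 : V)
    (x y b c : R) :
  short_linear lam -> 1 <= x -> 1 <= y -> `|x - y| <= b ->
  complex.Re (lam z0) <= c ->
  taylor_bound z0 rho
    (fun z => cexp (lam z * (ln x)%:C) - cexp (lam z * (ln y)%:C))
    (6 * (16 / rho ^+ 2) * (4 * (1 + nc (lam z0)) ^+ 2) *
     expR (b * (nc (lam z0) + 4)) * expR (ln y * (c - 7 / 8))).
Proof.
move=> lamP x1 y1 xyb cRe.
have y0 : 0 <= ln y by rewrite ln_ge0.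
have := @taylor_pow_diff _ _ _ z0 _ lamP rho_gt0 rho_le1 _ _ _ y0
  (le_trans (abs_lnB_le x1 y1) xyb).
apply: taylor_boundW; set K := 6 * _ * _.
have K0 : 0 <= K.
  apply: mulr_ge0; last by rewrite mulr_ge0 ?sqr_ge0.
  by apply: mulr_ge0; rewrite ?divr_ge0 ?sqr_ge0.
clearbody K; set w := nc (lam z0); have w0 : 0 <= w := nc_ge0 _.
have b0 : 0 <= b := le_trans (normr_ge0 _) xyb.
apply: (@le_trans _ _ (K * (expR (2 * b) / y) * expR (b * (w + 2)) *
    expR (ln y * (c + 1 / 8)))).
  apply: ler_pM; rewrite ?mulr_ge0 ?expR_ge0//.
    apply: ler_wpM2r; rewrite ?expR_ge0//; apply: ler_wpM2l => //.
    apply: le_trans (abs_lnB_le_expR x1 y1) _.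
    apply: ler_wpM2r; first by rewrite invr_ge0; lra.
    by rewrite ler_expR; lra.
  by rewrite ler_expR; apply: ler_wpM2l => //; lra.
have -> : y^-1 = expR (- ln y) by rewrite expRN lnK// posrE; lra.
have -> : K * (expR (2 * b) * expR (- ln y)) * expR (b * (w + 2)) *
    expR (ln y * (c + 1 / 8)) = K * (expR (2 * b) * expR (b * (w + 2))) *
    (expR (- ln y) * expR (ln y * (c + 1 / 8))) by ring.
rewrite -!expRD; apply: ler_pM; rewrite ?mulr_ge0 ?expR_ge0//.
  by apply: ler_wpM2l => //; rewrite ler_expR; lra.
by rewrite ler_expR; lra.
Qed.

Lemma short_linear_half : short_linear (fun w : C^o => w / 2).
Proof.
split=> [a u v|h]; first by rewrite /GRing.scale /=; ring.
have E2 : (2 : C) = (2 : R)%:C by rewrite rmorph_nat.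
rewrite ncM Normc.normcV E2 nc_real ger0_norm//.
by rewrite ler_piMr ?nc_ge0// invf_le1// ler1n.
Qed.

Lemma short_linear_id : short_linear (fun w : C^o => w : C).
Proof. by split. Qed.

Lemma short_linear_fst : short_linear (fun z : C^o * C^o => z.1 : C).
Proof.
split=> // h; rewrite -lecR -nrE -[leLHS]/(`|h.1|).
by rewrite prod_normE comparable_le_max ?lexx// real_comparable ?normr_real.
Qed.

Lemma short_linear_snd : short_linear (fun z : C^o * C^o => z.2 : C).
Proof.
split=> // h; rewrite -lecR -nrE -[leLHS]/(`|h.2|).
by rewrite prod_normE comparable_le_max ?lexx ?orbT// real_comparable ?normr_real.
Qed.

End analytic_sums.

(** * The alternating zeta function *)

Section continuation.
Variable R : realType.
Local Notation C := R[i].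
Local Notation nc := (@Normc.normc R).
Local Notation rho := (16^-1 : R).

Local Arguments cpow : simpl never.

Let rho_gt0 : 0 < rho. Proof. by rewrite invr_gt0. Qed.
Let rho_le1 : rho <= 1. Proof. by rewrite invf_le1// ler1n. Qed.

Lemma cpowS n (w : C) : cpow n.+1 w = cexp (w * (ln n.+1%:R)%:C).
Proof. by []. Qed.

Lemma nc_cpowS n (w : C) : nc (cpow n.+1 w) = expR (complex.Re w * ln n.+1%:R).
Proof. by rewrite cpowS nc_cexp Re_mulR. Qed.

Lemma cpowS0 n : cpow n.+1 0 = 1 :> C.
Proof. by rewrite cpowS mul0r cexp0. Qed.

Lemma cpowSD n (v w : C) : cpow n.+1 (v + w) = cpow n.+1 v * cpow n.+1 w.
Proof. by rewrite !cpowS mulrDl cexpD. Qed.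

Definition eta_term (j : nat) (w : C) : C :=
  cpow (2 * j).+1 w - 2 * cpow (2 * j).+2 w + cpow (2 * j).+3 w.

(* The alternating zeta function [\sum_(m >= 1) (-1)^(m-1) m^w], summed by second
   differences so that the series converges for [Re w < 1]. *)
Definition dirichlet_eta (w : C) : C :=
  1 / 2 + 1 / 2 * clim (fun N => \sum_(j < N) eta_term j w).

(** Reduces a second difference to first differences, for which [taylor_natpow_diff] applies. With
    [m ^+ 2 - p * q = 1], both the square and the correction are of order [j^(Re w - 2)]. *)
Lemma eta_termE j w :
  let p : R := (2 * j).+1%:R in let m : R := (2 * j).+2%:R in
  let q : R := (2 * j).+3%:R in
  eta_term j w =
  (cexp (w / 2 * (ln p)%:C) - cexp (w / 2 * (ln q)%:C)) ^+ 2 -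
  2 * (cexp (w / 2 * (ln (m ^+ 2))%:C) - cexp (w / 2 * (ln (p * q))%:C)).
Proof.
move=> p m q; rewrite /eta_term !cpowS -/p -/m -/q.
have split2 (x : R) : cexp (w * x%:C) = cexp (w / 2 * x%:C) ^+ 2.
  by rewrite [in LHS](splitr w) mulrDl cexpD expr2.
rewrite !split2 lnXn// lnM ?posrE// mulr2n !rmorphD /= !mulrDr !cexpD.
ring.
Qed.

(** A first difference of half powers has exponent [1/4 - 7/8 = -5/8]; its square has [-5/4], and so
    has the correction, because [p * q] is at least [(j + 1)^2]. *)
Lemma taylor_eta_term (z0 : C^o) : complex.Re z0 < 1 / 2 ->
  exists K : R, 0 <= K /\ forall j, taylor_bound z0 rho (eta_term j)
    (K * expR (- (1 + 1 / 4) * ln j.+1%:R)).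
Proof.
move=> z0Re; have hRe : complex.Re (z0 / 2) <= 1 / 4.
  have -> : z0 / 2 = z0 * (2^-1)%:C :> C by rewrite fmorphV rmorph_nat.
  rewrite Re_mulR; lra.
pose K1 := 6 * (16 / rho ^+ 2) * (4 * (1 + nc (z0 / 2)) ^+ 2) *
  expR (2 * (nc (z0 / 2) + 4)).
pose K2 := 6 * (16 / rho ^+ 2) * (4 * (1 + nc (z0 / 2)) ^+ 2) *
  expR (1 * (nc (z0 / 2) + 4)).
have K1_ge0 : 0 <= K1.
  apply: mulr_ge0 (expR_ge0 _); apply: mulr_ge0; last by rewrite mulr_ge0 ?sqr_ge0.
  by apply: mulr_ge0; rewrite ?divr_ge0 ?sqr_ge0.
have K2_ge0 : 0 <= K2.
  apply: mulr_ge0 (expR_ge0 _); apply: mulr_ge0; last by rewrite mulr_ge0 ?sqr_ge0.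
  by apply: mulr_ge0; rewrite ?divr_ge0 ?sqr_ge0.
exists (6 * K1 * K1 + nc (- 2) * K2); split.
  apply: addr_ge0; last by apply: mulr_ge0 => //; exact: nc_ge0.
  by apply: mulr_ge0 => //; apply: mulr_ge0.
move=> j; set p : R := (2 * j).+1%:R; set q : R := (2 * j).+3%:R.
set m : R := (2 * j).+2%:R; set l : R := ln j.+1%:R.
have p1 : 1 <= p by rewrite /p ler1n.
have q1 : 1 <= q by rewrite /q ler1n.
have m1 : 1 <= m by rewrite /m ler1n.
have pq2 : `|p - q| <= 2.
  have -> : q = p + 2 by rewrite /p /q -natrD addn2.
  by rewrite opprD addNKr normrN normr_nat.
have pj : j.+1%:R <= p by rewrite ler_nat ltnS leq_pmull.
have qj : j.+1%:R <= q by apply: le_trans pj _; rewrite ler_nat; exact/leqW/leqW.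
have j1 : 1 <= j.+1%:R :> R by rewrite ler1n.
have pq : m ^+ 2 - p * q = 1.
  rewrite /m /p /q -[(2 * j).+3%:R]natr1 -[(2 * j).+2%:R]natr1.
  by rewrite -[(2 * j).+1%:R]natr1; ring.
have pq1 : 1 <= p * q by rewrite -[leLHS]mulr1 ler_pM.
have m21 : 1 <= m ^+ 2 by lra.
have l_p : l <= ln p by rewrite ler_ln ?posrE//; lra.
have l_q : l <= ln q by rewrite ler_ln ?posrE//; lra.
have l_pq : 2 * l <= ln (p * q).
  by rewrite lnM ?posrE//; lra.
have T1 : taylor_bound z0 rho (fun w : C^o =>
    cexp (w / 2 * (ln p)%:C) - cexp (w / 2 * (ln q)%:C))
    (K1 * expR (- (5 / 8) * l)).
  have := taylor_natpow_diff (short_linear_half R) p1 q1 pq2 hRe.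
  apply: taylor_boundW; rewrite -/K1; apply: ler_wpM2l => //.
  by rewrite ler_expR; lra.
have T2 : taylor_bound z0 rho (fun w : C^o =>
    cexp (w / 2 * (ln (m ^+ 2))%:C) - cexp (w / 2 * (ln (p * q))%:C))
    (K2 * expR (- (1 + 1 / 4) * l)).
  have m2pq : `|m ^+ 2 - p * q| <= 1 by rewrite pq normr1.
  have := taylor_natpow_diff (short_linear_half R) m21 pq1 m2pq hRe.
  apply: taylor_boundW; rewrite -/K2; apply: ler_wpM2l => //.
  by rewrite ler_expR; lra.
have := taylor_boundD (taylor_boundM rho_le1 T1 T1) (taylor_boundZ (- 2) T2).
have -> : 6 * (K1 * expR (- (5 / 8) * l)) * (K1 * expR (- (5 / 8) * l)) +
   nc (- 2) * (K2 * expR (- (1 + 1 / 4) * l)) =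
   (6 * K1 * K1 + nc (- 2) * K2) * expR (- (1 + 1 / 4) * l).
  have -> : - (1 + 1 / 4) * l = - (5 / 8) * l + - (5 / 8) * l by field.
  rewrite expRD; ring.
congr (taylor_bound _ _ _ _); apply/funext => w.
by rewrite eta_termE -/p -/q -/m mulNr expr2.
Qed.

Lemma pseries54_le N :
  \sum_(j < N) expR (- (1 + 1 / 4) * ln j.+1%:R) <= 1 + (1 / 4)^-1 :> R.
Proof. exact: pseries_le. Qed.

Lemma eta_series_cvg (w : C) : complex.Re w < 1 / 2 ->
  ccvg (fun N => \sum_(j < N) eta_term j w)
    (clim (fun N => \sum_(j < N) eta_term j w)).
Proof.
move=> /taylor_eta_term [K [K0 TK]].
apply: (taylor_bound_series_cvg TK (B := K * (1 + (1 / 4)^-1))) => N.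
by rewrite -mulr_sumr ler_wpM2l// pseries54_le.
Qed.

Lemma eta0 : dirichlet_eta 0 = 1 / 2.
Proof.
have Re0 : complex.Re (0 : C) < 1 / 2 by rewrite /=; lra.
have c0 : ccvg (fun N => \sum_(j < N) eta_term j 0) 0.
  apply: ccvg_eq (ccvg_cst 0) => N; rewrite big1// => j _.
  by rewrite /eta_term !cpowS0; ring.
by rewrite /dirichlet_eta (ccvg_unique (eta_series_cvg Re0) c0) mulr0 addr0.
Qed.

Lemma differentiable_eta (w : C^o) : complex.Re w < 1 / 2 ->
  differentiable (dirichlet_eta : C^o -> C^o) w.
Proof.
move=> /taylor_eta_term [K [K0 TK]].
have := @taylor_bound_series _ _ w rho rho_le1 _ _ (K * (1 + (1 / 4)^-1))
  (ltW rho_gt0) TK.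
have sumK N : \sum_(j < N) K * expR (- (1 + 1 / 4) * ln j.+1%:R) <=
    K * (1 + (1 / 4)^-1).
  by rewrite -mulr_sumr ler_wpM2l// pseries54_le.
move=> /(_ sumK) /(taylor_boundZ (1 / 2)).
move=> /(taylor_boundD (taylor_bound_cst w rho (1 / 2))).
exact: taylor_bound_differentiable.
Qed.

(* For [Re w < -1], [dirichlet_eta w = (1 - 2^(1+w)) * \sum_(m >= 1) m^w]. *)
Lemma eta_partial (J : nat) (w : C) :
  1 / 2 + 1 / 2 * \sum_(j < J) eta_term j w =
  \sum_(m < 2 * J) cpow m.+1 w - cpow 2 (1 + w) * \sum_(m < J) cpow m.+1 w +
  1 / 2 * cpow (2 * J).+1 w.
Proof.
have cpow21 : cpow 2 (1 + w) = 2 * cpow 2 w.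
  rewrite cpowSD {1}cpowS mul1r cexp_real lnK ?posrE//.
  by rewrite rmorph_nat.
have even j : cpow 2 w * cpow j.+1 w = cpow (2 * j).+2 w.
  rewrite !cpowS -cexpD -mulrDr -rmorphD -lnM ?posrE// -natrM.
  by have -> : (2 * j.+1 = (2 * j).+2)%N by lia.
rewrite cpow21; elim: J => [|J IH].
  rewrite muln0 !big_ord0 !mulr0 addr0 subrr add0r cpowS ln1 rmorph0 mulr0 cexp0.
  by rewrite mulr1.
have -> : (2 * J.+1 = (2 * J).+2)%N by lia.
rewrite !big_ord_recr /= [1 / 2 * (_ + _)]mulrDr addrA IH /eta_term -even.
by field.
Qed.

End continuation.

(** * The zeta, tail and difference series *)

Section heat_continuation.
Variable R : realType.
Local Notation C := R[i].
Local Notation nc := (@Normc.normc R).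
Local Notation rho := (16^-1 : R).
Local Arguments cpow : simpl never.

Let rho_gt0 : 0 < rho. Proof. by rewrite invr_gt0. Qed.
Let rho_le1 : rho <= 1. Proof. by rewrite invf_le1// ler1n. Qed.

Lemma power_series_bounded (x : R) : x < -1 ->
  exists B, forall N, \sum_(m < N) expR (x * ln m.+1%:R) <= B.
Proof.
move=> x1; exists (1 + (- 1 - x)^-1) => N.
have e0 : 0 < -1 - x by lra.
apply: le_trans (pseries_le N e0); apply: ler_sum => m _.
by rewrite ler_expR; lra.
Qed.

Lemma one_sub_pow2_neq0 (w : C) : complex.Re w < -1 -> 1 - cpow 2 (1 + w) != 0.
Proof.
move=> w1; apply/eqP => /subr0_eq E.
have := nc_cpowS 1 (1 + w); rewrite -E nc1 Re_add => /esym/eqP.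
rewrite lt_eqF// expR_lt1 pmulr_llt0 ?ln_gt0 ?ltr1n//.
by rewrite /=; lra.
Qed.

(** Let [J] tend to infinity in [eta_partial]: the sums up to [2 J] and up to [J] have the same
    limit. *)
Lemma zeta_series_cvg (w : C) : complex.Re w < -1 ->
  ccvg (fun N => \sum_(m < N) cpow m.+1 w) (dirichlet_eta w / (1 - cpow 2 (1 + w))).
Proof.
move=> w1; have [B bB] := power_series_bounded w1.
have wB m : nc (cpow m.+1 w) <= expR (complex.Re w * ln m.+1%:R).
  by rewrite nc_cpowS.
have cZ := @abs_series_cvg _ (fun m => cpow m.+1 w) _ B wB bB.
set Z := clim _ in cZ.
suff -> : dirichlet_eta w = (1 - cpow 2 (1 + w)) * Z.
  by rewrite mulrAC divff ?mul1r// one_sub_pow2_neq0.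
have w12 : complex.Re w < 1 / 2 by lra.
have c1 := ccvgD (ccvg_cst (1 / 2)) (ccvgZ (1 / 2) (eta_series_cvg w12)).
(* The boundary term left over by summing second differences. *)
have c0 : ccvg (fun J => 1 / 2 * cpow (2 * J).+1 w) (1 / 2 * 0).
  apply: ccvgZ; apply: (@ccvg_le _ _ _ (fun J => 1 / J.+1%:R)); last exact: cvgn_invS.
  move=> J; rewrite subr0 nc_cpowS div1r -[leRHS]lnK ?posrE ?invr_gt0//.
  rewrite ler_expR lnV ?posrE//.
  have : ln J.+1%:R <= ln (2 * J).+1%:R :> R.
    by rewrite ler_ln ?posrE// ler_nat ltnS leq_pmull.
  have : 0 <= ln J.+1%:R :> R by rewrite ln_ge0// ler1n.
  move: (ln _) (ln _) => a b; nra.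
have c2 : ccvg (fun J => \sum_(m < 2 * J) cpow m.+1 w) Z.
  by apply: (ccvg_sub (f := fun J => (2 * J)%N) _ cZ) => i j; rewrite ltn_pmul2l.
have := ccvgD (ccvgB c2 (ccvgZ (cpow 2 (1 + w)) cZ)) c0.
rewrite mulr0 addr0 => c3; rewrite mulrBl mul1r; apply: (ccvg_unique c1).
by apply: ccvg_eq c3 => J; rewrite eta_partial.
Qed.

Variable t : R.
Hypothesis t_gt0 : 0 < t.

Definition tail_term (m : nat) (w : C) : C := (gauss_tail t m)%:C * cpow m.+1 w.

Definition tail_series (w : C) : C := clim (fun N => \sum_(m < N) tail_term m w).

(** The tails decay exponentially; they are weakened to [(m+1)^(-2)], which against the growth
    [(m+1)^(3/4)] leads to the same majorant of exponent [-5/4] as for [eta_term]. *)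
Lemma taylor_tail_term (z0 : C^o) : complex.Re z0 < 1 / 2 ->
  exists K : R, 0 <= K /\ forall m, taylor_bound z0 rho (tail_term m)
    (K * expR (- (1 + 1 / 4) * ln m.+1%:R)).
Proof.
move=> z0Re; set c := expR ((0 + 1) ^+ 2 / (4 * t)) * 4.
have c0 : 0 <= c by rewrite mulr_ge0 ?expR_ge0.
have r0 : 0 <= 16 / rho ^+ 2 by rewrite divr_ge0 ?sqr_ge0.
exists (c * expR 1 * 4 * (16 / rho ^+ 2)); split.
  by apply: mulr_ge0 => //; apply: mulr_ge0 => //; rewrite mulr_ge0 ?expR_ge0.
move=> m; set l : R := ln m.+1%:R; have l0 : 0 <= l by rewrite ln_ge0// ler1n.
have := taylor_boundZ (gauss_tail t m)%:C
  (taylor_cexp z0 (short_linear_id R) rho_gt0 rho_le1 l0).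
apply: taylor_boundW; rewrite nc_real ger0_norm ?gauss_tail_ge0//.
have tail : gauss_tail t m <= c * expR 1 * 4 * expR (- 2 * l).
  apply: le_trans (gauss_tail_le t_gt0 m) _; rewrite -/c.
  have -> : c * expR 1 * 4 * expR (- 2 * l) = c * (expR 1 * 4 * expR (- 2 * l)).
    by ring.
  apply: ler_wpM2l => //.
  have -> : - m%:R = 1 + - m.+1%:R :> R by rewrite -[m.+1%:R]natr1; ring.
  rewrite expRD -mulrA ler_pM2l ?expR_gt0//.
  have -> : - 2 * l = - (2 * l) by ring.
  rewrite [in leRHS]expRN ler_pdivlMr ?expR_gt0// mulrC.
  by rewrite expRM_natl lnK ?posrE// mul_expRN_le.
have -> : - (1 + 1 / 4) * l = - 2 * l + l * (3 / 4) by field.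
rewrite expRD [leLHS]mulrA [leRHS]mulrA.
have -> : c * expR 1 * 4 * (16 / rho ^+ 2) * expR (- 2 * l) =
  c * expR 1 * 4 * expR (- 2 * l) * (16 / rho ^+ 2) by ring.
apply: ler_pM; rewrite ?expR_ge0 ?mulr_ge0 ?gauss_tail_ge0//.
  exact: ler_wpM2r.
by rewrite ler_expR; apply: ler_wpM2l => //; lra.
Qed.

Lemma tail_series_cvg (w : C) : complex.Re w < 1 / 2 ->
  ccvg (fun N => \sum_(m < N) tail_term m w) (tail_series w).
Proof.
move=> /taylor_tail_term [K [K0 TK]].
apply: (taylor_bound_series_cvg TK (B := K * (1 + (1 / 4)^-1))) => N.
by rewrite -mulr_sumr ler_wpM2l// pseries54_le.
Qed.

Lemma differentiable_tail_series (w : C^o) : complex.Re w < 1 / 2 ->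
  differentiable (tail_series : C^o -> C^o) w.
Proof.
move=> /taylor_tail_term [K [K0 TK]].
have sumK N : \sum_(j < N) K * expR (- (1 + 1 / 4) * ln j.+1%:R) <=
    K * (1 + (1 / 4)^-1).
  by rewrite -mulr_sumr ler_wpM2l// pseries54_le.
have := @taylor_bound_series _ _ w rho rho_le1 _ _ (K * (1 + (1 / 4)^-1))
  (ltW rho_gt0) TK sumK.
exact: taylor_bound_differentiable.
Qed.

Lemma tail_series0 : tail_series 0 = (kappa t)%:C.
Proof.
have Re0 : complex.Re (0 : C) < 1 / 2 by rewrite /=; lra.
apply: (ccvg_unique (tail_series_cvg Re0)).
apply: ccvg_eq (ccvg_real (gauss_tail_cvg t_gt0)) => N.
by rewrite rmorph_sum; apply: eq_bigr => m _; rewrite /tail_term cpowS0 mulr1.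
Qed.

Definition square_sum (A : nmodType) (u : nat -> nat -> A) (N : nat) : A :=
  \sum_(n < N) \sum_(m < N) u n m.

(** The entries with [max n m = N]. Grouping by shells turns a double series into a single one, to
    which [taylor_bound_series] applies, with the square sums as partial sums. *)
Definition shell (A : nmodType) (u : nat -> nat -> A) (N : nat) : A :=
  \sum_(m < N.+1) u N m + \sum_(n < N) u n N.

Lemma sum_shell (A : nmodType) (u : nat -> nat -> A) N :
  \sum_(j < N) shell u j = square_sum u N.
Proof.
elim: N => [|N IH]; first by rewrite /square_sum !big_ord0.
rewrite /square_sum !big_ord_recr /= IH /shell big_ord_recr /=.
under [in RHS]eq_bigr => n _ do rewrite big_ord_recr /=.
rewrite big_split /= /square_sum -!addrA; congr (_ + _).
by rewrite [RHS]addrC -addrA.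
Qed.

Definition diff_term (n m : nat) (z : C^o * C^o) : C :=
  (expR (- t * (n%:R - m%:R) ^+ 2))%:C *
  ((cpow n.+1 z.1 - cpow m.+1 z.1) * (cpow n.+1 z.2 - cpow m.+1 z.2)).

Definition diff_series (z : C^o * C^o) : C :=
  clim (fun N => \sum_(j < N) shell (fun n m => diff_term n m z) j).

(** The two differences together give the exponent [Re s - 7/4 < -5/4] in [m + 1]. Their growth in
    [k = |n - m|] is [e^(k W)], which the heat weight turns into [e^(-k)] by [gauss_le]. *)
Lemma taylor_diff_term (z0 : C^o * C^o) : complex.Re (z0.1 + z0.2) < 1 / 2 ->
  exists K : R, 0 <= K /\ forall n m, taylor_bound z0 rho (diff_term n m)
    (K * expR (- `|n%:R - m%:R|) * expR (- (1 + 1 / 4) * ln m.+1%:R)).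
Proof.
rewrite Re_add => z0Re.
pose L (w : C) := 6 * (16 / rho ^+ 2) * (4 * (1 + nc w) ^+ 2).
have L0 w : 0 <= L w.
  apply: mulr_ge0; last by rewrite mulr_ge0 ?sqr_ge0.
  by apply: mulr_ge0; rewrite ?divr_ge0 ?sqr_ge0.
pose W := nc z0.1 + 4 + (nc z0.2 + 4).
pose G := expR ((W + 1) ^+ 2 / (4 * t)).
exists (6 * L z0.1 * L z0.2 * G); split.
  apply: mulr_ge0 (expR_ge0 _); apply: mulr_ge0 (L0 _).
  exact: mulr_ge0 (L0 _).
move=> n m; set k := `|n%:R - m%:R|.
have x1 : 1 <= n.+1%:R :> R by rewrite ler1n.
have y1 : 1 <= m.+1%:R :> R by rewrite ler1n.
have xyk : `|n.+1%:R - m.+1%:R| <= k.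
  by rewrite /k -[n.+1%:R]natr1 -[m.+1%:R]natr1 opprD addrACA subrr addr0.
have T1 := taylor_natpow_diff (short_linear_fst R) x1 y1 xyk (lexx (complex.Re z0.1)).
have T2 := taylor_natpow_diff (short_linear_snd R) x1 y1 xyk (lexx (complex.Re z0.2)).
have := taylor_boundZ (expR (- t * (n%:R - m%:R) ^+ 2))%:C (taylor_boundM rho_le1 T1 T2).
apply: taylor_boundW; rewrite nc_real ger0_norm ?expR_ge0//.
rewrite -/(L z0.1) -/(L z0.2); set l := ln _.
have l0 : 0 <= l by rewrite ln_ge0.
have -> : expR (- t * (n%:R - m%:R) ^+ 2) *
   (6 * (L z0.1 * expR (k * (nc z0.1 + 4)) *
      expR (l * (complex.Re z0.1 - 7 / 8))) *
    (L z0.2 * expR (k * (nc z0.2 + 4)) *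
      expR (l * (complex.Re z0.2 - 7 / 8)))) =
   6 * L z0.1 * L z0.2 * (expR (- t * (n%:R - m%:R) ^+ 2) *
    (expR (k * (nc z0.1 + 4)) * expR (k * (nc z0.2 + 4)))) *
    (expR (l * (complex.Re z0.1 - 7 / 8)) * expR (l * (complex.Re z0.2 - 7 / 8))).
  by ring.
rewrite -!expRD -!mulrDr -/W.
have -> : (n%:R - m%:R) ^+ 2 = k ^+ 2 by rewrite /k real_normK ?num_real.
have LL : 0 <= 6 * L z0.1 * L z0.2.
  by apply: mulr_ge0 (L0 _); apply: mulr_ge0 (L0 _).
apply: ler_pM; rewrite ?expR_ge0//.
- by apply: mulr_ge0 => //; exact: expR_ge0.
- by rewrite -[leRHS]mulrA; apply: ler_wpM2l => //; exact: gauss_le.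
- rewrite ler_expR; have -> : - (1 + 1 / 4) * l = l * (- (5 / 4)) by field.
  by apply: ler_wpM2l => //; lra.
Qed.

Lemma diff_bound_square_sum (K : R) N : 0 <= K ->
  square_sum (fun n m : nat => K * expR (- `|n%:R - m%:R|) *
    expR (- (1 + 1 / 4) * ln m.+1%:R)) N <= K * 4 * (1 + (1 / 4)^-1).
Proof.
move=> K0; rewrite /square_sum exchange_big /=.
apply: (@le_trans _ _ (\sum_(m < N) K * 4 * expR (- (1 + 1 / 4) * ln m.+1%:R))).
  apply: ler_sum => m _; rewrite -mulr_suml; apply: ler_wpM2r; first exact: expR_ge0.
  by rewrite -mulr_sumr ler_wpM2l// sum_expRN_dist_le.
by rewrite -mulr_sumr ler_wpM2l ?pseries54_le// mulr_ge0.
Qed.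

Lemma taylor_shell (z0 : C^o * C^o) (M : nat -> nat -> R)
    (u : nat -> nat -> C^o * C^o -> C) j :
  (forall n m, taylor_bound z0 rho (u n m) (M n m)) ->
  taylor_bound z0 rho (fun z => shell (fun n m => u n m z) j) (shell M j).
Proof.
move=> uM; rewrite /shell; apply: taylor_boundD.
  exact: (@taylor_bound_sum _ _ z0 rho _ _ (fun (m : 'I_j.+1) => u j m) (fun m => M j m)).
exact: (@taylor_bound_sum _ _ z0 rho _ _ (fun (n : 'I_j) => u n j) (fun n => M n j)).
Qed.

Lemma diff_series_cvg (z : C^o * C^o) : complex.Re (z.1 + z.2) < 1 / 2 ->
  ccvg (square_sum (fun n m => diff_term n m z)) (diff_series z).
Proof.
move=> /taylor_diff_term [K [K0 TK]].
have sumK N := diff_bound_square_sum N K0.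
have shellK N : \sum_(j < N) shell (fun n m : nat => K * expR (- `|n%:R - m%:R|) *
    expR (- (1 + 1 / 4) * ln m.+1%:R)) j <= K * 4 * (1 + (1 / 4)^-1).
  by rewrite sum_shell.
have := @taylor_bound_series_cvg _ _ z rho _ _ _
  (fun j => taylor_shell j TK) shellK.
by apply: ccvg_eq => N; rewrite sum_shell.
Qed.

Lemma differentiable_diff_series (z : C^o * C^o) : complex.Re (z.1 + z.2) < 1 / 2 ->
  differentiable (diff_series : C^o * C^o -> C^o) z.
Proof.
move=> /taylor_diff_term [K [K0 TK]].
have sumK N := diff_bound_square_sum N K0.
have shellK N : \sum_(j < N) shell (fun n m : nat => K * expR (- `|n%:R - m%:R|) *
    expR (- (1 + 1 / 4) * ln m.+1%:R)) j <= K * 4 * (1 + (1 / 4)^-1).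
  by rewrite sum_shell.
have := @taylor_bound_series _ _ z rho rho_le1 _ _ _ (ltW rho_gt0)
  (fun j => taylor_shell j TK) shellK.
exact: taylor_bound_differentiable.
Qed.

End heat_continuation.
(** * Unconditional sums and traces *)

Section square_summation.
Variable R : realType.
Local Notation C := R[i].
Local Notation nc := (@Normc.normc R).

Definition square (N : nat) : {fset nat * nat} :=
  [fset p in [seq (n, m) | n <- iota 0 N, m <- iota 0 N]]%fset.

Lemma in_square N p : (p \in square N) = (p.1 < N)%N && (p.2 < N)%N.
Proof.
rewrite !inE /=; apply/allpairsP/andP => [[[n m] /=]|[p1 p2]].
  by rewrite !mem_iota => -[? ? ->].
by exists p; rewrite !mem_iota -surjective_pairing.
Qed.

Lemma sum_square (A : nmodType) (F : nat * nat -> A) N :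
  \sum_(p <- square N) F p = square_sum (fun n m => F (n, m)) N.
Proof.
have -> : \sum_(p <- square N) F p =
    \sum_(p <- [seq (n, m) | n <- iota 0 N, m <- iota 0 N]) F p.
  apply: perm_big; apply: uniq_perm; first exact: fset_uniq.
    by rewrite allpairs_uniq ?iota_uniq// => -[? ?] [? ?].
  by move=> p; rewrite !inE.
rewrite big_allpairs /square_sum -(big_mkord xpredT (fun n => \sum_(m < N) F (n, m : nat))).
rewrite /index_iota subn0; apply: eq_bigr => n _.
by rewrite -(big_mkord xpredT (fun m => F (n, m))) /index_iota subn0.
Qed.

Lemma fset_sub_square (B : {fset nat * nat}) :
  exists N0, forall N, (N0 <= N)%N -> (B `<=` square N)%fset.
Proof.
exists (\sum_(p <- B) (p.1 + p.2).+1)%N => N BN; apply/fsubsetP => p pB.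
have : ((p.1 + p.2).+1 <= N)%N.
  apply: leq_trans BN; rewrite (big_rem p)//=; exact: leq_addr.
rewrite in_square; lia.
Qed.

Lemma sum_fset_cond (A : nmodType) (F : nat * nat -> A) (B S : {fset nat * nat}) :
  (B `<=` S)%fset -> \sum_(p <- S | p \in B) F p = \sum_(p <- B) F p.
Proof.
move=> /fsubsetP BS; rewrite -big_filter; apply: perm_big; apply: uniq_perm.
- by rewrite filter_uniq// fset_uniq.
- exact: fset_uniq.
- move=> p; rewrite mem_filter; have [pB|//] := boolP (p \in B).
  by rewrite BS.
Qed.

Variable u : nat * nat -> C.
Variable B : R.
Hypothesis uB : forall N, square_sum (fun n m => nc (u (n, m))) N <= B.

Lemma fset_sum_le (A : {fset nat * nat}) : \sum_(p <- A) nc (u p) <= B.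
Proof.
have [N0 /(_ _ (leqnn _)) AN] := fset_sub_square A.
apply: le_trans (uB N0).
rewrite -(sum_square (fun p => nc (u p))) [leRHS](bigID (mem A)) /=.
by rewrite sum_fset_cond// lerDl sumr_ge0// => p _; exact: nc_ge0.
Qed.

Lemma square_abs_summable : abs_summable u.
Proof.
rewrite /abs_summable /esum.summable; apply: (@le_lt_trans _ _ B%:E); last exact: ltry.
apply: ge_ereal_sup => _ [X [finX _] <-].
rewrite fsbig_finite//= (eq_bigr (fun p => (nc (u p))%:E)) => [|p _].
  by rewrite sumEFin lee_fin fset_sum_le.
by rewrite /= ger0_norm ?nc_ge0.
Qed.

(** Choose a square outside which the absolute mass is below [e / 2]. If [A] contains it, every
    larger square containing [A] differs from [A] only by terms outside the chosen one, so the sum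
    over [A] is within [e / 2] of [l] in the limit. *)
Lemma csum_square (l : C) :
  ccvg (square_sum (fun n m => u (n, m))) l -> csum u = l.
Proof.
move=> ul; pose sq N := square_sum (fun n m => nc (u (n, m))) N.
pose F := filter_from [set: {fset nat * nat}]
  (fun A => [set A' : {fset nat * nat} | (A `<=` A')%fset]).
have FF : ProperFilter F.
  apply: filter_from_proper => [|A _]; last by exists A => /=.
  apply: filter_from_filter; first by exists fset0.
  move=> A A' _ _; exists (A `|` A')%fset => // D /=.
  by rewrite fsubUset => /andP[].
have sq_mono N N' : (N <= N')%N -> sq N <= sq N'.
  move=> NN'; rewrite /sq -!(sum_square (fun p => nc (u p))).
  have sub : (square N `<=` square N')%fset.
    by apply/fsubsetP => p; rewrite !in_square; lia.
  rewrite [leRHS](bigID (mem (square N))) /= sum_fset_cond//.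
  by rewrite lerDl sumr_ge0// => p _; exact: nc_ge0.
have sq_cvg : cvgn sq.
  apply: nondecreasing_is_cvgn; first by move=> N N'; exact: sq_mono.
  by exists B => _ [N _ <-]; exact: uB.
apply: (@cvg_lim C^o (@norm_hausdorff _ C^o) _ F FF (fun A => \sum_(k <- A) u k) l).
apply/cvgrPdist_lt => e e0.
have e_real : e = (complex.Re e)%:C by rewrite RRe_real // gtr0_real.
have re0 : 0 < complex.Re e by rewrite -ltcR -e_real.
have re2 : 0 < complex.Re e / 2 by rewrite divr_gt0.
move/cvgrPdist_lt : (sq_cvg) => /(_ _ re2)[N _ /(_ N (leqnn N))] /= sqN.
exists (square N) => // A /= NA.
rewrite e_real -[ `|_| ]/((nc _)%:C) ltcR.
apply: (@le_lt_trans _ _ (complex.Re e / 2)); last lra.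
have [N0 AN0] := fset_sub_square A.
have lA : ccvg (fun n => square_sum (fun n m => u (n, m)) (n + N0)%N -
    \sum_(k <- A) u k) (l - \sum_(k <- A) u k).
  apply: ccvgB (ccvg_cst _).
  apply: (ccvg_sub (f := fun n => (n + N0)%N) _ ul) => i j.
  by rewrite ltn_add2r.
apply: (ccvg_nc_le _ lA) => n.
have AS := AN0 _ (leq_addl n N0).
rewrite -(sum_square u) [X in X - _](bigID (mem A)) /= sum_fset_cond// addrAC subrr add0r.
apply: le_trans (le_nc_sum _ _ _) _; apply/ltW; apply: le_lt_trans sqN.
apply: le_trans (ler_norm _).
have : sq (n + N0)%N <= limn sq.
  by apply: nondecreasing_cvgn_le => // i j; exact: sq_mono.
suff : \sum_(p <- square (n + N0) | p \notin A) nc (u p) <= sq (n + N0)%N - sq N.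
  by lra.
have NS := fsubset_trans NA AS.
rewrite lerBrDr /sq -!(sum_square (fun p => nc (u p))) [leRHS](bigID (mem A)) /=.
rewrite sum_fset_cond// addrC.
rewrite lerD2l [leRHS](bigID (mem (square N))) /= sum_fset_cond// lerDl.
by rewrite sumr_ge0// => p _; exact: nc_ge0.
Qed.

End square_summation.

(** * Square sums of the heat weights and their continuation *)

Section heat_square_sums.
Variable R : realType.
Local Notation C := R[i].
Local Notation nc := (@Normc.normc R).
Local Arguments cpow : simpl never.

Lemma ccvg_shiftS (s : nat -> C) l : ccvg (fun N => s N.+1) l -> ccvg s l.
Proof. by rewrite /ccvg => h; rewrite -cvg_shiftS. Qed.

Lemma cpow0 (w : C) : complex.Re w < 0 -> cpow 0 w = 0.
Proof.
move=> w0; rewrite /cpow; case: eqP => // E.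
by move: w0; rewrite E ltxx.
Qed.

Lemma square_sumS (A : nmodType) (u : nat -> nat -> A) N :
  (forall n, u n 0 = 0) -> (forall m, u 0 m = 0) ->
  square_sum u N.+1 = square_sum (fun n m => u n.+1 m.+1) N.
Proof.
move=> u0 u0'; rewrite /square_sum big_ord_recl big1 ?add0r => [|m _]; last exact: u0'.
by apply: eq_bigr => n _; rewrite big_ord_recl u0 add0r.
Qed.

Variable t : R.
Hypothesis t_gt0 : 0 < t.
Local Notation heat_weight := (fun n m : nat => expR (- t * (n%:R - m%:R) ^+ 2)).

(** Over all integers [n] the sum is [1 + 2 theta]; the window [0 <= n < N] misses the distances
    above [m] on the left and above [N - m - 1] on the right. *)
Lemma heat_row_sum N m : (m < N)%N ->
  \sum_(n < N) heat_weight n m =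
  1 + 2 * theta t - gauss_tail t m - gauss_tail t (N - m.+1)%N.
Proof.
move=> mN; have -> : N = (m + (N - m.+1).+1)%N by lia.
set r := (N - m.+1)%N; have -> : (m + r.+1 - m.+1 = r)%N by lia.
rewrite big_split_ord /= big_ord_recl /= addn0 subrr expr0n mulr0 expR0.
have -> : \sum_(i < m) heat_weight i m = \sum_(j < m) gauss t j.+1.
  rewrite (reindex_inj rev_ord_inj); apply: eq_bigr => j _ /=.
  rewrite /gauss -sqrrN opprB -natrB ?leq_subr//.
  by rewrite subKn.
have -> : \sum_(i < r) heat_weight (m + bump 0 i)%N m = \sum_(j < r) gauss t j.+1.
  by apply: eq_bigr => j _; rewrite /gauss natrD addrAC subrr add0r.
by rewrite /gauss_tail; ring.
Qed.

Lemma heat_column_cvg (s : C) : complex.Re s < -2 ->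
  ccvg (square_sum (fun n m => (heat_weight n m)%:C * cpow m.+1 s))
    ((1 + 2 * theta t)%:C * (dirichlet_eta s / (1 - cpow 2 (1 + s))) -
      tail_series t s).
Proof.
move=> s2; have s1 : complex.Re s < -1 by lra.
have s12 : complex.Re s < 1 / 2 by lra.
(* The left tails form [tail_series]; the right ones are only an effect of truncation and must
   vanish as [N] grows. *)
pose err N := \sum_(m < N) (gauss_tail t (N - m.+1))%:C * cpow m.+1 s.
have err0 : ccvg err 0.
  pose c := expR ((0 + 1) ^+ 2 / (4 * t)) * 4.
  have c0 : 0 <= c by rewrite mulr_ge0 ?expR_ge0.
  apply/ccvg_shiftS; apply: (@ccvg_le _ _ _
    (fun N => c * (4 * expR 1) / N.+1%:R)); last exact: cvgn_invS.
  move=> N; rewrite subr0; apply: le_trans (le_nc_sum _ _ _) _.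
  have term m : (m < N.+1)%N ->
      nc ((gauss_tail t (N.+1 - m.+1))%:C * cpow m.+1 s) <=
      c * (4 * expR 1) / N.+1%:R / N.+1%:R.
    move=> mN; rewrite ncM nc_cpowS nc_real ger0_norm ?gauss_tail_ge0//.
    set j := (N.+1 - m.+1)%N.
    (* The tail decays at least like [(j+1)^(-2)] and the power like [(m+1)^(-2)], so each of the
       [N + 1] terms is of order [(N+1)^(-2)]. This is where [Re s < -2] enters. *)
    have jm : (N.+1 <= j.+1 * m.+1)%N by rewrite /j; nia.
    have N0 : 0 < N.+1%:R :> R by [].
    have l0 : 0 <= ln m.+1%:R :> R by rewrite ln_ge0// ler1n.
    apply: (@le_trans _ _ (c * expR (- j%:R) * (m.+1%:R ^+ 2)^-1)).
      apply: ler_pM; rewrite ?gauss_tail_ge0 ?expR_ge0//.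
        exact: gauss_tail_le.
      rewrite -[leRHS]lnK ?posrE ?invr_gt0 ?exprn_gt0// ler_expR.
      by rewrite lnV ?posrE ?exprn_gt0// lnXn// mulr2n;
        have := ler_wpM2r l0 (ltW s2); lra.
    have -> : - j%:R = 1 + - j.+1%:R :> R by rewrite -[j.+1%:R]natr1; ring.
    have -> : c * (4 * expR 1) / N.+1%:R / N.+1%:R =
        c * (4 * expR 1 / N.+1%:R ^+ 2) by rewrite expr2 invfM !mulrA.
    rewrite expRD -[leLHS]mulrA; apply: ler_wpM2l => //.
    rewrite ler_pdivrMr ?exprn_gt0// mulrAC ler_pdivlMr ?exprn_gt0//.
    have h := @mul_expRN_le R j.+1.
    have jm' : N.+1%:R ^+ 2 <= j.+1%:R ^+ 2 * m.+1%:R ^+ 2 :> R.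
      by rewrite -exprMn lerXn2r ?nnegrE// -natrM ler_nat.
    move: h jm'.
    have := expR_gt0 (1 : R); have := expR_gt0 (- j.+1%:R : R).
    have : 0 <= m.+1%:R ^+ 2 :> R by rewrite exprn_ge0.
    move: (expR 1) (expR _) (N.+1%:R ^+ 2) (m.+1%:R ^+ 2) (j.+1%:R ^+ 2) =>
      a e n2 m2 j2 m0 e0 a0 h jm'.
    apply: (@le_trans _ _ (a * e * (j2 * m2))).
      by rewrite ler_wpM2l// mulr_ge0// ltW.
    have -> : a * e * (j2 * m2) = a * m2 * (j2 * e) by ring.
    have -> : 4 * a * m2 = a * m2 * 4 by ring.
    by rewrite ler_wpM2l// mulr_ge0// ltW.
  apply: (@le_trans _ _ (\sum_(m < N.+1) c * (4 * expR 1) / N.+1%:R / N.+1%:R)).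
    by apply: ler_sum => m _; exact: term.
  rewrite sumr_const card_ord -[leLHS]mulr_natr divfK//.
have := ccvgB (ccvgB (ccvgZ (1 + 2 * theta t)%:C (zeta_series_cvg s1))
  (tail_series_cvg t_gt0 s12)) err0.
rewrite subr0; apply: ccvg_eq => N.
rewrite /square_sum exchange_big /= mulr_sumr -!sumrB; apply: eq_bigr => m _.
rewrite -mulr_suml -rmorph_sum /= heat_row_sum// /tail_term.
move: (gauss_tail t m) (gauss_tail t (N - m.+1)) => x y.
by rewrite !rmorphB /=; ring.
Qed.

(** Here [zeta(-s)] is [dirichlet_eta s / (1 - 2^(1+s))]; the formula is meaningful for [Re s < 1/2]
    off the zeros of the denominator. *)
Definition heat_cont (z : C^o * C^o) : C^o :=
  (1 + 2 * theta t)%:C *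
    (dirichlet_eta (z.1 + z.2) / (1 - cpow 2 (1 + (z.1 + z.2)))) -
  tail_series t (z.1 + z.2) - 1 / 2 * diff_series t z.

(* Symmetrise [n^a m^b] and use
   [n^a m^b + n^b m^a = n^(a+b) + m^(a+b) - (n^a - m^a) (n^b - m^b)]. *)
Lemma heat_square_cvg (z : C^o * C^o) :
  complex.Re z.1 < -1 -> complex.Re z.2 < -1 ->
  ccvg (square_sum (fun n m => (heat_weight n m)%:C * cpow n z.1 * cpow m z.2))
    (heat_cont z).
Proof.
move=> z1 z2; have s2 : complex.Re (z.1 + z.2) < -2 by rewrite Re_add; lra.
have s12 : complex.Re (z.1 + z.2) < 1 / 2 by lra.
have := ccvgB (heat_column_cvg s2) (ccvgZ (1 / 2) (diff_series_cvg t_gt0 s12)).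
move=> lim; apply/ccvg_shiftS; apply: ccvg_eq lim => N.
rewrite square_sumS; last 2 first.
- by move=> n; rewrite cpow0 ?mulr0//; lra.
- by move=> m; rewrite (cpow0 (w := z.1)) ?mulr0 ?mul0r//; lra.
pose e n m : C := (heat_weight n m)%:C.
have eC n m : e n m = e m n by rewrite /e -sqrrN opprB.
have eS n m : e n.+1 m.+1 = e n m.
  by rewrite /e -[n.+1%:R]natr1 -[m.+1%:R]natr1 opprD addrACA subrr addr0.
under [RHS]eq_bigr => n _ do under eq_bigr => m _ do rewrite -/(e n.+1 m.+1) eS.
pose a (n : nat) : C := cpow n.+1 z.1; pose b (n : nat) : C := cpow n.+1 z.2.
rewrite /square_sum; set P := \sum_(n < N) _; set S := \sum_(n < N) _.
set D := \sum_(n < N) _.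
(* The weight [e] is symmetric, so exchanging the indices puts the full power on either variable in
   [P], and swaps the two exponents in [D]. Adding both forms makes the symmetric identity
   applicable termwise. *)
have PE : P = \sum_(n < N) \sum_(m < N) e n m * (a n * b n).
  rewrite /P exchange_big; apply: eq_bigr => n _; apply: eq_bigr => m _.
  by rewrite -/(e m n) eC cpowSD.
have PE' : P = \sum_(n < N) \sum_(m < N) e n m * (a m * b m).
  by apply: eq_bigr => n _; apply: eq_bigr => m _; rewrite cpowSD.
have DE : D = \sum_(n < N) \sum_(m < N) e n m * (a n * b m).
  by apply: eq_bigr => n _; apply: eq_bigr => m _; rewrite mulrA.
have DE' : D = \sum_(n < N) \sum_(m < N) e n m * (a m * b n).
  rewrite DE exchange_big; apply: eq_bigr => n _; apply: eq_bigr => m _.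
  by rewrite eC.
suff : S = P + P - (D + D) by move=> ->; field.
rewrite {1}PE PE' {1}DE DE' -!big_split -sumrB; apply: eq_bigr => n _.
rewrite -!big_split -sumrB; apply: eq_bigr => m _ /=.
by rewrite /diff_term -/(e n m) -/(a n) -/(a m) -/(b n) -/(b m); ring.
Qed.

(** Since [dirichlet_eta 0 = 1/2] and [1 - 2^1 = -1], the value is [- (1 + 2 theta) / 2 - kappa]. *)
Lemma heat_cont0 : heat_cont 0 = (- (1 / 2) - (kappa t + theta t))%:C.
Proof.
have D0 : diff_series t 0 = 0.
  have Re0 : complex.Re ((0 : C^o * C^o).1 + (0 : C^o * C^o).2) < 1 / 2.
    by rewrite addr0 /=; lra.
  apply: (ccvg_unique (diff_series_cvg t_gt0 Re0)).
  apply: ccvg_eq (ccvg_cst 0) => N; rewrite /square_sum big1// => n _.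
  by rewrite big1// => m _; rewrite /diff_term !cpowS0 subrr !mulr0.
have E2 : cpow 2 1 = 2 :> C by rewrite cpowS mul1r cexp_real lnK ?posrE// rmorph_nat.
rewrite /heat_cont D0 /= !addr0 eta0 tail_series0// E2 mulr0 subr0.
rewrite !(rmorphB, rmorphD, rmorphN, rmorphM, rmorph1, rmorph_nat, fmorphV) /=.
by field.
Qed.

End heat_square_sums.

(** * Boundary terms and gauged traces *)

Section heat_traces.
Variable R : realType.
Local Notation C := R[i].
Local Notation nc := (@Normc.normc R).
Local Arguments cpow : simpl never.
Local Notation heat_weight t := (fun n m : nat => expR (- t * (n%:R - m%:R) ^+ 2)).

Lemma boundary_square_sum (t : R) N : 0 < t ->
  square_sum (fun n m : nat => if (n * m == 0)%N then heat_weight t n m else 0) N.+1 =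
  1 + 2 * \sum_(j < N) gauss t j.+1.
Proof.
move=> t0; rewrite /square_sum !big_ord_recl /= subrr expr0n mulr0 expR0.
rewrite -addrA; congr (1 + _); rewrite mulr_natl mulr2n; congr (_ + _).
  apply: eq_bigr => m _; rewrite /gauss sub0r sqrrN.
  by [].
apply: eq_bigr => n _; rewrite big_ord_recl /= muln0 eqxx big1 => [|m _].
  by rewrite addr0 /gauss subr0.
by [].
Qed.

Lemma boundary_csum (t : R) : 0 < t ->
  csum (fun k : nat * nat =>
    if (k.1 * k.2 == 0)%N then (expR (- t * (k.1%:R - k.2%:R) ^+ 2))%:C else 0) =
  (1 + 2 * theta t)%:C.
Proof.
move=> t0.
pose v n m : R := if (n * m == 0)%N then heat_weight t n m else 0.
have ncE n m : nc (if (n * m == 0)%N then (heat_weight t n m)%:C else 0) = v n m.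
  by rewrite /v; case: ifP => _; rewrite ?nc0// nc_real ger0_norm// expR_ge0.
have bnd N : square_sum v N <= 1 + 2 * theta t.
  case: N => [|N].
    rewrite /square_sum big_ord0 addr_ge0// mulr_ge0//.
    by have := gauss_tail_ge0 t0 0; rewrite /gauss_tail big_ord0 subr0.
  by rewrite boundary_square_sum// lerD2l ler_wpM2l// partial_theta_le.
apply: (@csum_square _ _ (1 + 2 * theta t)) => [N|].
  rewrite (_ : square_sum _ N = square_sum v N)//.
  by apply: eq_bigr => n _; apply: eq_bigr => m _; exact: ncE.
apply/ccvg_shiftS.
have lim : (fun N => 1 + 2 * \sum_(j < N) gauss t j.+1) @ \oo --> 1 + 2 * theta t.
  by apply: cvgD; [exact: cvg_cst|apply: cvgMr; exact: theta_cvg].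
apply: ccvg_eq (ccvg_real lim) => N; rewrite -boundary_square_sum//.
rewrite rmorph_sum; apply: eq_bigr => n _; rewrite rmorph_sum.
by apply: eq_bigr => m _; case: ifP.
Qed.

Section gauged.
Variables (I : finType) (alpha : I -> C^o * C^o -> C^o) (delta1 delta2 : I -> R).

(** At [z = 0] all powers of 1 are 1, so testing the identity on [R_{1,1}] reads off the sum. This
    normalisation makes the value at the origin independent of the gauge. *)
Lemma gauge_alpha_sum :
  (forall x : T0 R, gauge alpha delta1 delta2 (0, 0) x = x) ->
  \sum_i alpha i 0 = 1.
Proof.
move=> /(_ (Rnm R 1 1)); rewrite gaugeE => /(congr1 (mcoeff (1%N, 1%N))).
rewrite mcoeffZ mcoeffUU mulr1 => <-; apply: eq_bigr => i _.
by rewrite /= !mulr0 !cpowS0 !mulr1.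
Qed.

Definition gauge_symbol (z : C^o * C^o) (n m : nat) : C :=
  \sum_i alpha i z * cpow n ((delta1 i)%:C * z.1) * cpow m ((delta2 i)%:C * z.2).

Lemma eigenv_heat_gauge (t : R) z k :
  eigenv (heat t \o gauge alpha delta1 delta2 z) k =
  (heat_weight t k.1 k.2)%:C * gauge_symbol z k.1 k.2.
Proof.
rewrite /eigenv /=; apply: etrans (heat_coef _ _ _) _; congr (_ * _).
rewrite gaugeE mcoeffZ /Rnm -surjective_pairing mcoeffUU mulr1.
by [].
Qed.

Variable z : C^o * C^o.
Hypothesis z_neg : forall i, delta1 i * complex.Re z.1 < -1 /\
  delta2 i * complex.Re z.2 < -1.

Let Re1 i : complex.Re ((delta1 i)%:C * z.1) < -1.
Proof. by rewrite mulrC Re_mulR mulrC; have [] := z_neg i. Qed.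

Let Re2 i : complex.Re ((delta2 i)%:C * z.2) < -1.
Proof. by rewrite mulrC Re_mulR mulrC; have [] := z_neg i. Qed.

Lemma cpow_sum_bounded (w : C) : complex.Re w < -1 ->
  exists2 B, 0 <= B & forall N, \sum_(n < N) nc (cpow n w) <= B.
Proof.
move=> w1; have [B bB] := power_series_bounded w1.
have B0 : 0 <= B by have := bB 0%N; rewrite big_ord0.
exists B => // -[|N]; first by rewrite big_ord0.
rewrite big_ord_recl cpow0 ?nc0 ?add0r; last lra.
by apply: le_trans (bB N); apply: ler_sum => n _; rewrite nc_cpowS.
Qed.

(** Bounding the heat weight by 1 leaves, for each [i], a product of two one-variable series; hence
    [t = 0] is allowed. *)
Lemma heat_gauge_bounded (t : R) : 0 <= t ->
  exists B, forall N, square_sum (fun n m =>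
    nc (eigenv (heat t \o gauge alpha delta1 delta2 z) (n, m))) N <= B.
Proof.
move=> t0.
have /choice[B1 HB1] i : exists B, 0 <= B /\ forall N,
    \sum_(n < N) nc (cpow n ((delta1 i)%:C * z.1)) <= B.
  by have [B] := cpow_sum_bounded (Re1 i); exists B.
have /choice[B2 HB2] i : exists B, 0 <= B /\ forall N,
    \sum_(n < N) nc (cpow n ((delta2 i)%:C * z.2)) <= B.
  by have [B] := cpow_sum_bounded (Re2 i); exists B.
exists (\sum_i nc (alpha i z) * (B1 i * B2 i)) => N.
apply: (@le_trans _ _ (\sum_(n < N) \sum_(m < N) \sum_i nc (alpha i z) *
  (nc (cpow n ((delta1 i)%:C * z.1)) * nc (cpow m ((delta2 i)%:C * z.2))))).
  apply: ler_sum => n _; apply: ler_sum => m _.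
  rewrite eigenv_heat_gauge ncM nc_real ger0_norm ?expR_ge0//=.
  apply: (@le_trans _ _ (nc (gauge_symbol z n m))).
    rewrite ler_piMl ?nc_ge0// expR_le1 mulNr oppr_le0.
    by rewrite mulr_ge0 ?sqr_ge0.
  apply: le_trans (le_nc_sum _ _ _) _; apply: ler_sum => i _.
  by rewrite !ncM mulrA.
under eq_bigr do rewrite exchange_big /=.
rewrite exchange_big /=; apply: ler_sum => i _.
under eq_bigr do rewrite -mulr_sumr -mulr_sumr.
rewrite -mulr_sumr ler_wpM2l ?nc_ge0// -mulr_suml.
have [b1 h1] := HB1 i; have [b2 h2] := HB2 i.
by apply: ler_pM; rewrite ?h1 ?h2// sumr_ge0// => *; exact: nc_ge0.
Qed.

Lemma heat_gauge_trace_class (t : R) : 0 <= t ->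
  trace_class (heat t \o gauge alpha delta1 delta2 z).
Proof.
move=> t0; split; last first.
  by have [B HB] := heat_gauge_bounded t0; apply: square_abs_summable HB.
move=> n m; rewrite eigenv_heat_gauge /= gaugeE; apply/malgP => k.
apply: etrans (heat_coef _ _ _) _; rewrite !mcoeffZ /Rnm !mcoeffU.
by case: eqP => [<-|_] /=; rewrite ?mulr0// !mulr1.
Qed.

Lemma heat_gauge_sptrace (t : R) : 0 < t ->
  sptrace (heat t \o gauge alpha delta1 delta2 z) =
  \sum_i alpha i z *
    heat_cont t ((delta1 i)%:C * z.1, (delta2 i)%:C * z.2).
Proof.
move=> t0; have [B HB] := heat_gauge_bounded (ltW t0).
apply: (csum_square HB).
have H (s : seq I) : ccvg (fun N => \sum_(i <- s) alpha i z *
    square_sum (fun n m => (heat_weight t n m)%:C *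
      cpow n ((delta1 i)%:C * z.1) * cpow m ((delta2 i)%:C * z.2)) N)
    (\sum_(i <- s) alpha i z *
    heat_cont t ((delta1 i)%:C * z.1, (delta2 i)%:C * z.2)).
  elim: s => [|i s IH].
    by rewrite big_nil; apply: ccvg_eq (ccvg_cst 0) => N; rewrite big_nil.
  rewrite big_cons; have hi := @heat_square_cvg _ _ t0
    ((delta1 i)%:C * z.1, (delta2 i)%:C * z.2) (Re1 i) (Re2 i).
  by apply: ccvg_eq (ccvgD (ccvgZ (alpha i z) hi) IH) => N; rewrite big_cons.
apply: ccvg_eq (H (index_enum I)) => N.
rewrite /square_sum; under eq_bigr do rewrite mulr_sumr.
rewrite exchange_big /=; apply: eq_bigr => n _.
under eq_bigr do rewrite mulr_sumr.
rewrite exchange_big /=; apply: eq_bigr => m _.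
rewrite eigenv_heat_gauge /= mulr_sumr; apply: eq_bigr => i _.
ring.
Qed.

End gauged.
End heat_traces.
(** * The domain of the continuation and its iterated limit *)

Section domains.
Variables (R : realType) (V : normedModType R[i]).
Local Notation C := R[i].
Local Notation nc := (@Normc.normc R).

Definition cconvex (A : set V) := forall x y (s : R), A x -> A y ->
  0 <= s <= 1 -> A (x + s%:C *: (y - x)).

Lemma cconvex_connected (A : set V) : cconvex A -> connected A.
Proof.
move=> Aconv; have [[x Ax]|A0] := pselect (A !=set0); last first.
  suff -> : A = set0 by exact: connected0.
  by rewrite -subset0 => x Ax; apply: A0; exists x.
pose path y (s : R) : V := x + s%:C *: (y - x).
have path_cont y : continuous (path y).
  move=> s; apply: cvgD; first exact: cvg_cst.
  apply: cvgZr_tmp.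
  apply: (@cvg_real_complex R R (nbhs s) _ id s). exact: cvg_id.
have path0 y : path y 0 = x by rewrite /path scale0r addr0.
have path1 y : path y 1 = y by rewrite /path scale1r addrC subrK.
have -> : A = \bigcup_(y in A) (path y @` `[0, 1]%classic).
  apply/seteqP; split=> [y Ay|_ [y Ay [s s01 <-]]].
    by exists y => //; exists 1; rewrite ?path1//= in_itv /= ler01 lexx.
  by apply: Aconv => //; move: s01; rewrite /= in_itv.
apply: bigcup_connected => [|y Ay].
  exists x => y Ay; exists 0; rewrite ?path0//= in_itv /= lexx ler01.
  by [].
apply: connected_continuous_connected; first exact: segment_connected.
exact: continuous_subspaceT.
Qed.

Variables (I : finType) (lam : I -> V -> C).
Hypothesis lam_linear : forall i (a : C) u v, lam i (a *: u + v) = a * lam i u + lam i v.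
Hypothesis lam_cont : forall i, continuous (lam i : V -> C^o).

(* Three convex pieces, consecutive ones meeting, that join the half-space of
   absolute convergence to a neighbourhood of [0] without meeting the
   solutions of [2 ^ (1 + lam i v) = 1]. *)
Definition left_piece : set V := [set v | forall i, complex.Re (lam i v) < -1].
Definition upper_piece : set V := [set v | forall i,
  [/\ 0 < complex.Im (lam i v), complex.Im (lam i v) < 1 &
      complex.Re (lam i v) < 1 / 2]].
Definition central_piece : set V := [set v | forall i,
  -1 < complex.Re (lam i v) /\ complex.Re (lam i v) < 1 / 2].
Definition domain : set V := left_piece `|` (upper_piece `|` central_piece).

Let Re_cont i : continuous (fun v => complex.Re (lam i v)).
Proof.
move=> v; apply/cvgrPdist_lt => e e0.
have e0' : 0 < e%:C by rewrite ltcR.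
have /cvgrPdist_lt/(_ _ e0') := @lam_cont i v; apply: filterS => w.
rewrite -[ `|_| ]/((nc _)%:C) ltcR; apply: le_lt_trans.
have -> : complex.Re (lam i v) - complex.Re (lam i w) =
  complex.Re (lam i v - lam i w) by case: (lam i v); case: (lam i w).
exact: le_Re_nc.
Qed.

Let Im_cont i : continuous (fun v => complex.Im (lam i v)).
Proof.
move=> v; apply/cvgrPdist_lt => e e0.
have e0' : 0 < e%:C by rewrite ltcR.
have /cvgrPdist_lt/(_ _ e0') := @lam_cont i v; apply: filterS => w.
rewrite -[ `|_| ]/((nc _)%:C) ltcR; apply: le_lt_trans.
have -> : complex.Im (lam i v) - complex.Im (lam i w) =
  complex.Im (lam i v - lam i w) by case: (lam i v); case: (lam i w).
exact: le_Im_nc.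
Qed.

Let lam_segment i x y (s : R) :
  lam i (x + s%:C *: (y - x)) = lam i x + (lam i y - lam i x) * s%:C.
Proof.
have lamN u v : lam i (u - v) = lam i u - lam i v.
  by rewrite addrC -scaleN1r lam_linear; ring.
by rewrite addrC lam_linear lamN; ring.
Qed.

Let Re_segment i x y (s : R) : complex.Re (lam i (x + s%:C *: (y - x))) =
  (1 - s) * complex.Re (lam i x) + s * complex.Re (lam i y).
Proof.
rewrite lam_segment Re_add Re_mulR.
by case: (lam i x) (lam i y) => a b [c d] /=; ring.
Qed.

Let Im_segment i x y (s : R) : complex.Im (lam i (x + s%:C *: (y - x))) =
  (1 - s) * complex.Im (lam i x) + s * complex.Im (lam i y).
Proof.
rewrite lam_segment Im_add Im_mulR.
by case: (lam i x) (lam i y) => a b [c d] /=; ring.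
Qed.

Let lt_segment (a b c s : R) : 0 <= s <= 1 -> a < c -> b < c ->
  (1 - s) * a + s * b < c.
Proof. by move=> /andP[s0 s1] ac bc; have [s2|s2] := leP s (1 / 2); nra. Qed.

Let gt_segment (a b c s : R) : 0 <= s <= 1 -> c < a -> c < b ->
  c < (1 - s) * a + s * b.
Proof. by move=> /andP[s0 s1] ac bc; have [s2|s2] := leP s (1 / 2); nra. Qed.

Lemma left_piece_convex : cconvex left_piece.
Proof. by move=> x y s Ax Ay s01 i; rewrite Re_segment lt_segment. Qed.

Lemma upper_piece_convex : cconvex upper_piece.
Proof.
move=> x y s Ax Ay s01 i; rewrite Re_segment Im_segment.
have [? ? ?] := Ax i; have [? ? ?] := Ay i.
by rewrite !lt_segment// gt_segment.
Qed.

Lemma central_piece_convex : cconvex central_piece.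
Proof.
move=> x y s Ax Ay s01 i; rewrite Re_segment.
have [? ?] := Ax i; have [? ?] := Ay i.
by rewrite lt_segment// gt_segment.
Qed.

Lemma open_domain : open domain.
Proof.
have Re_lt i c : open [set v | complex.Re (lam i v) < c].
  apply: (@open_comp _ _ (fun v => complex.Re (lam i v)) [set x | x < c]) => [v _|].
    exact: Re_cont.
  exact: open_lt.
have Re_gt i c : open [set v | c < complex.Re (lam i v)].
  apply: (@open_comp _ _ (fun v => complex.Re (lam i v)) [set x | c < x]) => [v _|].
    exact: Re_cont.
  exact: open_gt.
have Im_lt i c : open [set v | complex.Im (lam i v) < c].
  apply: (@open_comp _ _ (fun v => complex.Im (lam i v)) [set x | x < c]) => [v _|].
    exact: Im_cont.
  exact: open_lt.
have Im_gt i c : open [set v | c < complex.Im (lam i v)].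
  apply: (@open_comp _ _ (fun v => complex.Im (lam i v)) [set x | c < x]) => [v _|].
    exact: Im_cont.
  exact: open_gt.
have open_forall (P : I -> set V) : (forall i, open (P i)) ->
    open [set v | forall i, P i v].
  move=> Po; rewrite openE => v Pv; apply: filter_forall => i.
  by apply: open_nbhs_nbhs; split; [exact: Po|exact: Pv].
apply: openU.
  by apply: (open_forall (fun i => [set v | complex.Re (lam i v) < -1])) => i.
apply: openU.
  pose P i : set V := [set v | 0 < complex.Im (lam i v)] `&`
    [set v | complex.Im (lam i v) < 1] `&` [set v | complex.Re (lam i v) < 1 / 2].
  have -> : upper_piece = [set v | forall i, P i v].
    apply/seteqP; split=> v vP i; first by have [? ? ?] := vP i.
    by have [[? ?] ?] := vP i.
  by apply: (open_forall P) => i; apply: openI => //; apply: openI.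
apply: (@open_forall (fun i => [set v | -1 < complex.Re (lam i v)] `&`
   [set v | complex.Re (lam i v) < 1 / 2])) => i.
exact: openI.
Qed.

Variables (e : V) (c : I -> R).
Hypotheses (c_gt0 : forall i, 0 < c i) (lam_e : forall i, lam i e = (c i)%:C).

Let lamZ i a : lam i (a *: e) = a * (c i)%:C.
Proof.
have lam0 : lam i 0 = 0.
  by have := lam_linear i (-1) 0 0; rewrite scaler0 addr0 mulN1r addNr.
by rewrite -[a *: e]addr0 lam_linear lam0 addr0 lam_e.
Qed.

(** On complex multiples of [e] all forms [lam i] are positive multiples of one number, so a single
    point can be placed in two pieces for all [i] at once. *)
Lemma connected_domain : connected domain.
Proof.
(* [X * c i > 1] and [0 < y * c i < 1] for every [i]: the point [(- X + i y) e] is common to the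
   left and upper pieces, [(i y) e] to the upper and central ones. *)
pose X : R := 1 + \sum_i (c i)^-1; pose y : R := (1 + \sum_i c i)^-1.
have cX i : 1 < X * c i.
  rewrite -ltr_pdivrMr// div1r /X (bigD1 i)//= addrCA ltrDl.
  by rewrite ltr_pwDl// sumr_ge0// => j _; rewrite invr_ge0 ltW.
have sum0 : 0 < 1 + \sum_i c i by rewrite ltr_pwDl// sumr_ge0// => j _; exact: ltW.
have y0 : 0 < y by rewrite invr_gt0.
have cy i : y * c i < 1.
  rewrite mulrC ltr_pdivrMr// mul1r (bigD1 i)//= addrCA ltrDl.
  by rewrite ltr_pwDl// sumr_ge0// => j _; exact: ltW.
have cX0 i : 0 < y * c i by rewrite mulr_gt0.
apply: connectedU; last 2 first.
- by apply: cconvex_connected; exact: left_piece_convex.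
- apply: connectedU; last 2 first.
  + by apply: cconvex_connected; exact: upper_piece_convex.
  + by apply: cconvex_connected; exact: central_piece_convex.
  exists ((0 +i* y) *: e); split=> i; rewrite lamZ Re_mulR ?Im_mulR /=.
    by split=> //; lra.
  by split; lra.
exists ((- X +i* y) *: e); split=> [i|]; first by rewrite lamZ Re_mulR /=; have := cX i; lra.
by left=> i; rewrite lamZ Re_mulR ?Im_mulR /=; split=> //; have := cX i; lra.
Qed.

Lemma domain0 : domain 0.
Proof.
have lam0 i : lam i 0 = 0 by have := lamZ i 0; rewrite scale0r mul0r.
by right; right=> i; rewrite lam0 /=; split; lra.
Qed.

Lemma domain_Re_lt i v : domain v -> complex.Re (lam i v) < 1 / 2.
Proof. by case=> [/(_ i)|[/(_ i)[]//|/(_ i)[]//]] => vP; lra. Qed.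

(** In the left and central pieces the modulus of [2^(1 + lam i v)] is below and above 1. In the
    upper piece its imaginary part is positive, because the argument lies between 0 and
    [ln 2 < 2]. *)
Lemma domain_pow2_neq1 i v : domain v -> 1 - cpow 2 (1 + lam i v) != 0.
Proof.
have ln2 : 0 < ln 2 :> R by rewrite ln_gt0// ltr1n.
have ln21 : ln 2 < 2 :> R by rewrite ln_sublinear.
case=> [/(_ i)|[/(_ i)[Im0 Im1 _]|/(_ i)[Re1 _]]]; first exact: one_sub_pow2_neq0.
- apply/eqP => /subr0_eq; rewrite cpowS => /(congr1 (@complex.Im R)).
  have Im_cexp (w : C) :
      complex.Im (cexp w) = expR (complex.Re w) * sin (complex.Im w).
    by rewrite /cexp /= mul0r addr0.
  rewrite Im_cexp Im_mulR Im_add /= add0r => /eqP.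
  rewrite eq_sym mulf_eq0 gt_eqF ?expR_gt0//= gt_eqF// sin2_gt0//.
  rewrite mulr_gt0//=; nra.
- apply/eqP => /subr0_eq E.
  have := nc_cpowS 1 (1 + lam i v); rewrite -E nc1 Re_add => /eqP.
  rewrite lt_eqF// expR_gt1 mulr_gt0//.
  by rewrite /=; lra.
Qed.

End domains.

(** * Holomorphy of the continuation and the value at the origin *)

Section zeta_function.
Variable R : realType.
Local Notation C := R[i].
Local Notation nc := (@Normc.normc R).
Local Arguments cpow : simpl never.

Lemma differentiable_short_linear (V : normedModType C) (lam : V -> C) (z : V) :
  short_linear lam -> differentiable (lam : V -> C^o) z.
Proof.
move=> [lamL lam1]; have lamD u v : lam (u + v) = lam u + lam v.
  by have := lamL 1 u v; rewrite scale1r mul1r.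
apply: (@taylor_bound_differentiable _ _ z 1 lam (1 + nc (lam z))) => //.
exists lam; split=> // [|h|h _]; first by rewrite lerDr.
- by rewrite (le_trans (lam1 h))// ler_peMl ?nr_ge0// lerDl nc_ge0.
- by rewrite lamD addrAC addrK subrr nc0 mulr_ge0 ?exprn_ge0 ?nr_ge0// addr_ge0 ?nc_ge0.
Qed.

Lemma differentiable_pow2 (w : C^o) :
  differentiable (fun w : C^o => cpow 2 (1 + w) : C^o) w.
Proof.
have ln2 : 0 <= ln 2 :> R by rewrite ln_ge0// ler1n.
have := taylor_boundZ (cexp (ln 2)%:C)
  (taylor_cexp w (short_linear_id R) ltr01 (lexx 1) ln2).
move=> /(taylor_bound_differentiable ltr01).
congr (differentiable _ _); apply/funext => v.
by rewrite cpowS mulrDl mul1r cexpD.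
Qed.

Lemma differentiable_heat_cont (t : R) (z : C^o * C^o) : 0 < t ->
  complex.Re (z.1 + z.2) < 1 / 2 -> 1 - cpow 2 (1 + (z.1 + z.2)) != 0 ->
  differentiable (heat_cont t) z.
Proof.
move=> t0 zRe z1.
have ds : differentiable (fun z : C^o * C^o => z.1 + z.2 : C^o) z.
  exact: differentiableD (differentiable_short_linear z (short_linear_fst R))
    (differentiable_short_linear z (short_linear_snd R)).
have d_eta := differentiable_comp ds (differentiable_eta zRe).
have d_tail := differentiable_comp ds (differentiable_tail_series t0 zRe).
have d_pow := differentiable_comp ds (@differentiable_pow2 (z.1 + z.2)).
have d_one (c : C^o) : differentiable (fun _ : C^o * C^o => c) z.
  exact: differentiable_cst.
have d_inv : differentiable
    (fun z : C^o * C^o => (1 - cpow 2 (1 + (z.1 + z.2)))^-1 : C^o) z.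
  have d_den : differentiable
      (fun z : C^o * C^o => 1 - cpow 2 (1 + (z.1 + z.2)) : C^o) z.
    exact: differentiableB (d_one 1) d_pow.
  exact: differentiableV d_den z1.
have d1 := differentiableM (d_one (1 + 2 * theta t)%:C) (differentiableM d_eta d_inv).
have d2 := differentiableM (d_one (1 / 2)) (differentiable_diff_series t0 zRe).
exact: differentiableB (differentiableB d1 d_tail) d2.
Qed.

Lemma dnbhs_continuous (V W : normedModType C) (f : V -> W) (v : V) :
  differentiable f v -> f x @[x --> v^'] --> f v.
Proof.
move=> /differentiable_continuous cf; apply: (@cvg_trans _ (f x @[x --> v])).
  by move=> A; exact: nbhs_dnbhs.
exact: cf.
Qed.

Lemma differentiable_slice1 (f : C^o * C^o -> C^o) (v w : C^o) :
  differentiable f (v, w) -> differentiable (fun z1 => f (z1, w)) v.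
Proof.
move=> df; have dv := differentiable_short_linear v (short_linear_id R).
have dw : differentiable (fun _ : C^o => w) v by exact: differentiable_cst.
exact: differentiable_comp (differentiable_pair dv dw) df.
Qed.

Lemma differentiable_slice2 (f : C^o * C^o -> C^o) (v w : C^o) :
  differentiable f (v, w) -> differentiable (fun z2 => f (v, z2)) w.
Proof.
move=> df; have dw := differentiable_short_linear w (short_linear_id R).
have dv : differentiable (fun _ : C^o => v) w by exact: differentiable_cst.
exact: differentiable_comp (differentiable_pair dv dw) df.
Qed.

(** Since [0] lies in [W], both limits at the origin are limits of continuous functions, whatever
    [W] and [g] are. This determines the value chosen by [xget] in [Htr]. *)
Lemma iterated_limit_unique (U : set (C^o * C^o)) (f : C^o * C^o -> C^o) (l : C^o) :
  holomorphic U f -> iterated_limit U f l -> l = f 0.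
Proof.
move=> hf [W [g [[Wo Wc hg W0] [_ Wf gl]]]]; have [U0 fg] := Wf 0 W0.
have gl' := dnbhs_continuous (hg 0 W0).
have fg' := dnbhs_continuous (differentiable_slice1 (hf (0, 0) U0)).
have -> : l = g 0 by apply: (cvg_unique (@norm_hausdorff _ C^o) gl gl').
exact: (cvg_unique (@norm_hausdorff _ C^o) fg fg').
Qed.

Section extension.
Variables (I : finType) (alpha : I -> C^o * C^o -> C^o) (delta1 delta2 : I -> R).
Hypotheses (holo_alpha : forall i, holomorphic [set: C^o * C^o] (alpha i))
  (delta1_gt0 : forall i, 0 < delta1 i) (delta2_gt0 : forall i, 0 < delta2 i)
  (alpha_sum : \sum_i alpha i 0 = 1).
Variable t : R.
Hypothesis t_gt0 : 0 < t.

Definition weight_sum (i : I) (z : C^o * C^o) : C :=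
  (delta1 i)%:C * z.1 + (delta2 i)%:C * z.2.

(** The restriction of [weight_sum] to [z.1 = 0], so that [domain weight2] is the slice along which
    the inner limit is continued. *)
Definition weight2 (i : I) (w : C^o) : C := (delta2 i)%:C * w.

Definition gauged_cont (z : C^o * C^o) : C^o :=
  \sum_i alpha i z * heat_cont t ((delta1 i)%:C * z.1, (delta2 i)%:C * z.2).

Let scale_linear (c : C) (lam : C^o * C^o -> C) (z : C^o * C^o) :
  short_linear lam -> differentiable (fun z => c * lam z : C^o) z.
Proof.
move=> lamP; have dc : differentiable (fun _ : C^o * C^o => c : C^o) z.
  exact: differentiable_cst.
exact: differentiableM dc (differentiable_short_linear z lamP).
Qed.

Let weight_sum_linear i (a : C) u v :
  weight_sum i (a *: u + v) = a * weight_sum i u + weight_sum i v.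
Proof.
rewrite /weight_sum.
have -> : (a *: u + v).1 = a * u.1 + v.1 :> C by [].
have -> : (a *: u + v).2 = a * u.2 + v.2 :> C by [].
ring.
Qed.

Let weight2_linear i (a : C) (u v : C^o) :
  weight2 i (a *: u + v) = a * weight2 i u + weight2 i v.
Proof.
by rewrite /weight2; have -> : a *: u + v = a * u + v :> C by []; ring.
Qed.

Let weight_sum_cont i : continuous (weight_sum i : C^o * C^o -> C^o).
Proof.
move=> z; apply: differentiable_continuous.
exact: differentiableD (scale_linear _ z (short_linear_fst R))
  (scale_linear _ z (short_linear_snd R)).
Qed.

Let weight2_cont i : continuous (weight2 i : C^o -> C^o).
Proof.
move=> w; apply: differentiable_continuous.
have dc : differentiable (fun _ : C^o => (delta2 i)%:C : C^o) w.
  exact: differentiable_cst.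
exact: differentiableM dc (differentiable_short_linear w (short_linear_id R)).
Qed.

Lemma differentiable_gauged_cont z :
  domain weight_sum z -> differentiable gauged_cont z.
Proof.
move=> zU; rewrite /gauged_cont.
have term i : differentiable (fun z : C^o * C^o => alpha i z *
    heat_cont t ((delta1 i)%:C * z.1, (delta2 i)%:C * z.2) : C^o) z.
  apply: differentiableM; first exact: holo_alpha.
  have dpair := differentiable_pair
    (scale_linear (delta1 i)%:C z (short_linear_fst R))
    (scale_linear (delta2 i)%:C z (short_linear_snd R)).
  apply: (differentiable_comp dpair); apply: differentiable_heat_cont => //=.
    exact: domain_Re_lt zU.
  exact: domain_pow2_neq1 zU.
elim: (index_enum I) => [|i s IH].
  have -> : (fun z => \sum_(i <- [::]) alpha i z *
      heat_cont t ((delta1 i)%:C * z.1, (delta2 i)%:C * z.2)) = cst (0 : C^o).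
    by apply/funext => v; rewrite big_nil.
  exact: differentiable_cst.
have -> : (fun z => \sum_(i <- i :: s) alpha i z *
    heat_cont t ((delta1 i)%:C * z.1, (delta2 i)%:C * z.2)) =
  (fun z => alpha i z * heat_cont t ((delta1 i)%:C * z.1, (delta2 i)%:C * z.2)) +
  (fun z => \sum_(i <- s) alpha i z *
    heat_cont t ((delta1 i)%:C * z.1, (delta2 i)%:C * z.2)).
  by apply/funext => v; rewrite big_cons.
exact: differentiableD.
Qed.

Lemma gauged_cont0 : gauged_cont 0 = (- (1 / 2) - (kappa t + theta t))%:C.
Proof.
rewrite /gauged_cont -[RHS]mul1r -alpha_sum mulr_suml; apply: eq_bigr => i _.
have -> : ((delta1 i)%:C * (0 : C^o * C^o).1, (delta2 i)%:C * (0 : C^o * C^o).2) =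
  0 :> C^o * C^o by rewrite !mulr0.
by rewrite heat_cont0.
Qed.

(** The threshold lies below every [- 1 / d i], so one half-plane serves all indices. *)
Let delta_bound (d : I -> R) : (forall i, 0 < d i) ->
  forall i x, x < - (1 + \sum_i (d i)^-1) -> d i * x < -1.
Proof.
move=> d0 i x; rewrite (bigD1 i)//= => xd.
have s0 : 0 <= \sum_(j | j != i) (d j)^-1.
  by apply: sumr_ge0 => j _; rewrite invr_ge0 ltW.
have : x < - (d i)^-1 by lra.
by rewrite -(ltr_pM2l (d0 i)) mulrN divff// gt_eqF.
Qed.

Lemma gauged_cont_extension :
  holo_extension (fun z => heat t \o gauge alpha delta1 delta2 z)
    (domain weight_sum) gauged_cont.
Proof.
split.
- exact: open_domain weight_sum_cont.
- apply: (@connected_domain _ _ _ _ weight_sum_linear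
    ((1, 1) : C^o * C^o) (fun i => delta1 i + delta2 i)) => i.
    exact: addr_gt0.
  by rewrite /weight_sum /= !mulr1 rmorphD.
- by move=> z zU; exact: differentiable_gauged_cont.
exists (Num.min (- (1 + \sum_i (delta1 i)^-1)) (- (1 + \sum_i (delta2 i)^-1))).
move=> z; rewrite !lt_min => /andP[z11 z12] /andP[z21 z22].
have z_neg i : delta1 i * complex.Re z.1 < -1 /\ delta2 i * complex.Re z.2 < -1.
  by split; apply: delta_bound.
split.
- left=> i; rewrite /weight_sum Re_add ![_%:C * _]mulrC !Re_mulR.
  by have [] := z_neg i; rewrite !(mulrC (complex.Re _)); lra.
- exact: heat_gauge_trace_class z_neg _ (ltW t_gt0).
- by rewrite heat_gauge_sptrace.
Qed.

(** Stated for any [f] that extends [gauged_cont], so that it serves both the explicit extension and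
    the maximal one. *)
Lemma gauged_cont_iterated_limit (U : set (C^o * C^o)) (f : C^o * C^o -> C^o) :
  domain weight_sum `<=` U ->
  (forall z, domain weight_sum z -> gauged_cont z = f z) ->
  iterated_limit U f (gauged_cont 0).
Proof.
move=> DU Df.
have slice w : domain weight2 w -> domain weight_sum (0, w).
  have E i : weight_sum i (0, w) = weight2 i w by rewrite /weight_sum mulr0 add0r.
  by case=> [h|[h|h]]; [left|right; left|right; right] => i; rewrite E; exact: h.
have D0 : domain weight2 0.
  apply: (@domain0 _ _ _ _ weight2_linear 1 delta2) => // i.
  by rewrite /weight2 mulr1.
exists (domain weight2), (fun w => gauged_cont (0, w)); split; split=> //.
- exact: open_domain weight2_cont.
- apply: (@connected_domain _ _ _ _ weight2_linear (1 : C^o) delta2) => // i.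
  by rewrite /weight2 mulr1.
- move=> w /slice /differentiable_gauged_cont; exact: differentiable_slice2.
- exists (- (1 + \sum_i (delta2 i)^-1)) => w ws; left=> i.
  by rewrite /weight2 mulrC Re_mulR mulrC; exact: delta_bound.
- move=> w /slice wD; split; first exact: DU.
  have := dnbhs_continuous (differentiable_slice1 (differentiable_gauged_cont wD)).
  apply: cvg_trans; apply: near_eq_cvg.
  have dw := differentiable_continuous (differentiable_pair
    (differentiable_short_linear (0 : C^o) (short_linear_id R))
    (differentiable_cst w (0 : C^o))).
  have : \forall z1 \near (0 : C^o), domain weight_sum (z1, w).
    apply: dw; apply: open_nbhs_nbhs; split=> //; exact: open_domain weight_sum_cont.
  move=> nD; apply: nbhs_dnbhs; move: nD; apply: filterS => z1 z1D.
  exact: Df.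
- apply: (dnbhs_continuous (f := fun w : C^o => gauged_cont (0, w))).
  exact: differentiable_slice2 (differentiable_gauged_cont (slice _ D0)).
Qed.

End extension.
End zeta_function.

Theorem theorem4p4 (R : realType) (I : finType)
    (alpha : I -> R[i]^o * R[i]^o -> R[i]^o) (delta1 delta2 : I -> R)
    (holo_alpha : forall i, holomorphic [set: R[i]^o * R[i]^o] (alpha i))
    (delta1_gt0 : forall i, 0 < delta1 i)
    (delta2_gt0 : forall i, 0 < delta2 i)
    (gauge0 : forall x : T0 R, gauge alpha delta1 delta2 (0, 0) x = x) :
  (forall z : R[i]^o * R[i]^o,
     (forall i, delta1 i * complex.Re z.1 < -1 /\
                delta2 i * complex.Re z.2 < -1) ->
     forall t : R, 0 <= t ->
       trace_class (heat t \o gauge alpha delta1 delta2 z)) /\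
  (forall t : R, 0 < t ->
     exists U f,
       holo_extension (fun z => heat t \o gauge alpha delta1 delta2 z) U f /\
       iterated_limit U f
         (- (1 / 2) - nsum (fun k => (k%:R + 1) * expR (- t * k%:R ^+ 2)))%:C) /\
  (forall (dom : R -> set (R[i]^o * R[i]^o)) (zeta : R -> R[i]^o * R[i]^o -> R[i]^o),
     (forall t : R, 0 < t ->
        is_zeta (fun z => heat t \o gauge alpha delta1 delta2 z)
          (dom t) (zeta t)) ->
     [/\ forall t : R, 0 < t ->
           iterated_limit (dom t) (zeta t)
             (- (1 / 2) - nsum (fun k => (k%:R + 1) * expR (- t * k%:R ^+ 2)))%:C,
         forall t : R, 0 < t ->
           Htr t (dom t) (zeta t) =
             (1 / 2 - nsum (fun k => (k%:R - 1) * expR (- t * k%:R ^+ 2)))%:C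
       & (((4 * pi * t)%:C * Htr t (dom t) (zeta t) : R[i]^o) @[t --> (0 : R)^'+])
           --> ((- (2 * pi))%:C : R[i]^o)]).

Proof.
have alpha_sum := gauge_alpha_sum gauge0.
have valueE t : 0 < t -> gauged_cont alpha delta1 delta2 t 0 =
    (- (1 / 2) - nsum (fun k => (k%:R + 1) * expR (- t * k%:R ^+ 2)))%:C.
  by move=> t0; rewrite gauged_cont0// -(nsum_plus t0).
split=> [z z_neg t|]; first exact: heat_gauge_trace_class.
split=> [t t0|dom zeta zetaP].
  exists (domain (weight_sum delta1 delta2)), (gauged_cont alpha delta1 delta2 t).
  split; first exact: gauged_cont_extension.
  by rewrite -valueE//; exact: gauged_cont_iterated_limit.
have limit t : 0 < t -> iterated_limit (dom t) (zeta t)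
    (gauged_cont alpha delta1 delta2 t 0).
  (* Maximality, applied to the explicit extension, gives the inclusion of domains and the equality
     of values. *)
  move=> t0; have [_ /(_ _ _ (gauged_cont_extension holo_alpha _ _ t0))] := zetaP t t0.
  by case=> // DU Df; exact: gauged_cont_iterated_limit.
have HtrE t : 0 < t -> Htr t (dom t) (zeta t) = (1 / 2 - (kappa t - theta t))%:C.
  move=> t0; have [[_ _ holo_zeta _] _] := zetaP t t0.
  rewrite /Htr boundary_csum//.
  have -> : xget 0 [set l : R[i]^o | iterated_limit (dom t) (zeta t) l] =
      gauged_cont alpha delta1 delta2 t 0.
    case: xgetP => [l _ /= lP|/(_ (gauged_cont alpha delta1 delta2 t 0))].
      by rewrite (iterated_limit_unique holo_zeta lP)
        (iterated_limit_unique holo_zeta (limit t t0)).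
    by case; exact: limit.
  (* The boundary terms add [1 + 2 theta] to [- 1/2 - kappa - theta]. *)
  by rewrite gauged_cont0// -rmorphD; congr (_%:C); field.
split=> [t t0|t t0|].
- by rewrite -valueE//; exact: limit.
- by rewrite HtrE// -(nsum_minus t0).
- have lim := @cvg_real_complex R _ _ _ _ _ (@heat_trace_limit R).
  apply: (@cvg_trans _ (((4 * pi * t * (1 / 2 - (kappa t - theta t)))%:C : R[i]^o)
    @[t --> (0 : R)^'+])); last exact: lim.
  apply: near_eq_cvg; near=> t; have t0 : 0 < t by near: t; exact: nbhs_right_gt.
  by rewrite HtrE// -rmorphM.
Unshelve. all: by end_near. Qed.
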